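(* Let $M$ be a compact connected smooth manifold with boundary. The set $\mathcal G(M)$ of Riemannian metrics $g$ of the gradient type on $M$ is open in the space $\mathcal R(M)$ of all Riemannian metrics on $M$, considered in the $C^\infty$-topology.
   Context: $SM\to M$ is the unit tangent bundle of $(M,g)$ and $v^g$ is the vector field on $SM$ generating the geodesic flow of $g$. The metric $g$ is of the gradient type if there exists a smooth function $F:SM\to\mathbb R$ such that $dF(v^g)>0$. *)

(* Defs.v *)
From HB Require Import structures.
From mathcomp Require Import all_boot all_order all_algebra.
From mathcomp Require Import all_classical all_reals all_analysis.
Set Implicit Arguments.
Unset Strict Implicit.
Unset Printing Implicit Defensive.
Import Order.TTheory GRing.Theory Num.Theory.
Import numFieldNormedType.Exports.
Local Open Scope classical_set_scope.
Local Open Scope ring_scope.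

Section calculus.
Context {R : realType} {n : nat}.
Implicit Types (A W : set 'rV[R]_n) (f : 'rV[R]_n -> R) (s : seq 'I_n).

Definition partials s f : 'rV[R]_n -> R :=
  foldr (fun i h => 'D_(delta_mx 0 i) h) f s.

Definition smooth_open W f : Prop :=
  forall s x, W x -> differentiable (partials s f) x.

(* On an arbitrary subset: local extendability to a smooth function. *)
Definition smooth_on A f : Prop :=
  forall x, A x -> exists W h,
    [/\ open W, W x, smooth_open W h & forall y, A y -> W y -> h y = f y].

(* The condition only bears on the coordinate of index 0, so that the          *)
(* half-space of R^0 is R^0.                                                   *)
Definition halfspace : set 'rV[R]_n :=
  [set x | forall i : 'I_n, i = 0%N :> nat -> 0 <= x 0 i].

(* Partial derivative relative to the half-space: two-sided inside, one-sided  *)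
(* in the inward direction on the boundary. It only depends on the values of f *)
(* at the points of the half-space close to x.                                 *)
Definition hpartial (i : 'I_n) f (x : 'rV[R]_n) : R :=
  lim ((fun h : R => h^-1 * (f (x + h *: delta_mx 0 i) - f x)) @
    within (fun h : R => halfspace (x + h *: delta_mx 0 i)) 0^').

Definition hpartials s f : 'rV[R]_n -> R := foldr hpartial f s.

End calculus.

(* A homeomorphism from an open subset of T onto a relatively open subset of   *)
(* the half-space; cfun and cinv are arbitrary off cdom and cfun @` cdom.      *)
Record chart (R : realType) (n : nat) (T : topologicalType) := Chart {
  cdom : set T;
  cfun :> T -> 'rV[R]_n;
  cinv : 'rV[R]_n -> T;
  cdom_open : open cdom;
  cimg_open : exists2 V : set 'rV[R]_n,
    open V & cfun @` cdom = V `&` halfspace;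
  cfunK : forall p, cdom p -> cinv (cfun p) = p;
  cfun_continuous : {within cdom, continuous cfun};
  cinv_continuous : {within cfun @` cdom, continuous cinv} }.

Definition cimg R n T (c : chart R n T) : set 'rV[R]_n := c @` cdom c.

Definition smooth_transition R n T (c c' : chart R n T) : Prop :=
  forall j : 'I_n,
    smooth_on (c @` (cdom c `&` cdom c')) (fun x => c' (cinv c x) 0 j).

(* Smooth manifolds of dimension n, with possibly empty boundary.              *)
Record manifold (R : realType) (n : nat) := Manifold {
  carrier :> topologicalType;
  atlas : set (chart R n carrier);
  atlas_cover : forall p, exists2 c, atlas c & cdom c p;
  atlas_smooth : forall c c', atlas c -> atlas c' -> smooth_transition c c';
  manifold_hausdorff : hausdorff_space carrier;
  manifold_second_countable : @second_countable carrier }.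

Section riemannian.
Context {R : realType} {n : nat} (M : manifold R n).
Implicit Types (c : chart R n M) (p : M).

(* Jacobian matrix of the change of charts, acting on row vectors on the right *)
Definition jac c c' (x : 'rV[R]_n) : 'M[R]_n :=
  \matrix_(i, j) hpartial i (fun y => c' (cinv c y) 0 j) x.

(* Elements of TM: a base point together with the components in all the charts *)
(* around it; the components in irrelevant charts are 0, so that equality of   *)
(* records is equality of tangent vectors.                                     *)
Record tangent := Tangent {
  base : M;
  comp : chart R n M -> 'rV[R]_n;
  comp_out : forall c, ~ (atlas c /\ cdom c base) -> comp c = 0;
  comp_change : forall c c', atlas c -> atlas c' ->
    cdom c base -> cdom c' base ->
    comp c' = comp c *m jac c c' (c base) }.

(* A Riemannian metric is given by its matrix gmx c x in the chart c at the    *)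
(* point of coordinates x; irrelevant values are 0, for the same reason.       *)
Record metric := Metric {
  gmx : chart R n M -> 'rV[R]_n -> 'M[R]_n;
  gmx_out : forall c x, ~ (atlas c /\ cimg c x) -> gmx c x = 0;
  gmx_smooth : forall c, atlas c ->
    forall i j, smooth_on (cimg c) (fun x => gmx c x i j);
  gmx_sym : forall c x, atlas c -> cimg c x -> (gmx c x)^T = gmx c x;
  gmx_posdef : forall c x (v : 'rV[R]_n), atlas c -> cimg c x -> v != 0 ->
    0 < (v *m gmx c x *m v^T) 0 0;
  gmx_change : forall c c' p, atlas c -> atlas c' -> cdom c p -> cdom c' p ->
    gmx c (c p) = jac c c' (c p) *m gmx c' (c' p) *m (jac c c' (c p))^T }.

HB.instance Definition _ := gen_eqMixin metric.
HB.instance Definition _ := gen_choiceMixin metric.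

(* The C^infty topology: uniform convergence on compact sets, in charts, of    *)
(* the components and of all their partial derivatives.                        *)
Definition Cinfty_subbase : set (set metric) :=
  [set B | exists (g0 : metric) c (K : set M) (r : nat) (e : R),
    [/\ atlas c, compact K, K `<=` cdom c, 0 < e &
     B = [set g | forall (s : seq 'I_n) p i j, (size s <= r)%N -> K p ->
       `|hpartials s (fun x => gmx g c x i j) (c p)
         - hpartials s (fun x => gmx g0 c x i j) (c p)| < e]]].

HB.instance Definition _ :=
  @isSubBaseTopological.Build metric (set metric) Cinfty_subbase id.

Section gradient.
Variable g : metric.

Definition unit_tangent : set tangent :=
  [set u | forall c, atlas c -> cdom c (base u) ->
     (comp u c *m gmx g c (c (base u)) *m (comp u c)^T) 0 0 = 1].

Definition tchart c (u : tangent) : 'rV[R]_(n + n) :=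
  row_mx (c (base u)) (comp u c).

Definition christoffel c (k i j : 'I_n) (x : 'rV[R]_n) : R :=
  let d a b e := hpartial a (fun y => gmx g c y b e) x in
  2^-1 * \sum_(l < n) invmx (gmx g c x) k l * (d i j l + d j i l - d l i j).

(* The geodesic vector field, i.e. the geodesic equation x'' = - Gamma(x', x') *)
(* as a first-order system, in the coordinates tchart c                        *)
Definition geodesic_field c (u : tangent) : 'rV[R]_(n + n) :=
  let v := comp u c in
  row_mx v (\row_k - \sum_(i < n) \sum_(j < n)
                       christoffel c k i j (c (base u)) * v 0 i * v 0 j).

(* h is a smooth function on the open set W which extends F, read in the       *)
(* coordinates tchart c.                                                       *)
Definition extends (F : unit_tangent -> R) c (W : set 'rV[R]_(n + n))
    (h : 'rV[R]_(n + n) -> R) : Prop :=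
  [/\ open W, smooth_open W h &
      forall u : unit_tangent, cdom c (base (val u)) -> W (tchart c (val u)) ->
        h (tchart c (val u)) = F u].

(* Smoothness on the embedded submanifold SM of TM                             *)
Definition smooth_SM (F : unit_tangent -> R) : Prop :=
  forall (u : unit_tangent) c, atlas c -> cdom c (base (val u)) ->
    exists W h, extends F c W h /\ W (tchart c (val u)).

(* The differential of F at u, in the coordinates tchart c; as w is tangent to *)
(* SM, the derivative does not depend on the smooth extension of F.            *)
Definition dSM (F : unit_tangent -> R) c (u : unit_tangent)
    (w : 'rV[R]_(n + n)) : R :=
  xget 0 [set l | exists W h, [/\ extends F c W h, W (tchart c (val u)) &
                                  l = 'D_w h (tchart c (val u))]].

Definition gradient_type : Prop :=
  exists2 F : unit_tangent -> R, smooth_SM F &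
    forall (u : unit_tangent) c, atlas c -> cdom c (base (val u)) ->
      0 < dSM F c u (geodesic_field c (val u)).

End gradient.
End riemannian.

(* Main.v *)
From Pilot Require Import Defs.
From mathcomp Require Import all_boot all_order all_algebra.
From mathcomp Require Import all_classical all_reals all_analysis.
From mathcomp Require Import ring lra.

(** Let [g0] be of gradient type, with function [F] on its unit tangent bundle.
    Extend [F] to all nonzero tangent vectors by making it constant along rays
    ([radial_ext]); for every other metric [g] this gives, by restriction, a
    smooth function on the unit tangent bundle of [g] ([smooth_radial_ext]).  In
    a chart, all these functions have one and the same smooth extension [H] to
    an open set of pairs (point, vector), and the derivative of [H] along the
    geodesic field of [g] at [(x, v)] is a continuous function of [x], [v] and
    the 1-jet of [g] at [x], positive for [g = g0] and [v] of norm 1.  It stays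
    positive for nearby data ([geodesic_derive_positive]); compactness of the
    spheres of unit vectors, then of [M], makes this uniform, so that every
    metric close to [g0] in the C^1 sense is of gradient type.

    Two points need care.  First, the derivative of a function on the unit
    tangent bundle is defined through an arbitrary smooth extension of it, and
    positivity is required in all charts of the atlas, of which there may be
    infinitely many.  Both are settled by [extends_geodesic_derive]: extensions
    in two charts (possibly the same) have the same derivative along the
    geodesic field, because both differentiate the function along a single curve
    of unit vectors tangent to that field.  That the curve is tangent to the
    field in both charts is the transformation law of the Christoffel symbols
    ([gamma_change]), which follows from Koszul's formula and the symmetry of
    second derivatives ([derive_sym]).

    Second, at the boundary nothing is known on one side of the half-space.  The
    curve above projects onto a straight segment in the first chart, and from a
    point of the half-space any straight line stays in it for positive or for
    negative times; a derivative is determined by either ([half_line_cvg]).  The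
    same remark shows that the derivatives of a smooth extension at a point of
    the half-space depend only on the function which it extends
    ([derive_halfspace], [hpartialE]), hence the chain rule for changes of
    charts ([jac_comp]). *)

Set Implicit Arguments.
Unset Strict Implicit.
Unset Printing Implicit Defensive.
Import Order.TTheory GRing.Theory Num.Theory.
Import numFieldNormedType.Exports.
(* For [comp] to denote the components of a tangent vector, not the composition
   of functions *)
Import Pilot.Defs.
Local Open Scope classical_set_scope.
Local Open Scope ring_scope.

(** * Derivatives and half-lines *)

Section differential.
Context {R : realType}.

Lemma near_eq_differentiable (V W : normedModType R) (f g : V -> W) (x : V) :
  (\near x, f x = g x) -> differentiable f x -> differentiable g x.
Proof.
move=> fg df; have [dfc /eqaddoP fo] := (diff_locallyP _ _).1 df.
have go : g \o shift x = cst (g x) + 'd f x +o_ 0 id.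
  apply/eqaddoP => e e0; have fo' := fo e e0.
  have fg' : \forall h \near (0 : V), f (h + x) = g (h + x).
    by have := fg; rewrite (near_shift 0) /=; apply: filterS => h; rewrite subr0.
  apply: filterS2 fg' fo' => h hfg; rewrite /= !fctE /= hfg.
  by rewrite (nbhs_singleton fg).
by apply/diff_locallyP; split; rewrite (diff_unique dfc go).
Qed.

(** Derivatives along a vector become derivatives of curves, for which being
    derivable and being differentiable are the same. *)
Lemma is_derive_line (V W : normedModType R) (f : V -> W) x v d :
  is_derive x v f d <-> is_derive (0 : R) 1 (fun t => f (t *: v + x)) d.
Proof.
have E : 'D_v f x = 'D_1 (fun t : R => f (t *: v + x)) 0.
  rewrite /derive; set g1 := fun h => h^-1 *: _; set g2 := fun h => h^-1 *: _.
  suff -> : g1 = g2 by []; apply/funext => h; rewrite /g1 /g2 /=.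
  by rewrite addr0 scale0r add0r [_%:A]mulr1.
split=> -[df dE].
  by apply: DeriveDef; [exact: (derivable1P f x v).1 | rewrite -E].
by apply: DeriveDef; [exact: (derivable1P f x v).2 | rewrite E].
Qed.

Lemma is_derive_diff (V W : normedModType R) (f : V -> W) x v :
  differentiable f x -> is_derive x v f ('D_v f x).
Proof. by move=> df; apply/derivableP/diff_derivable. Qed.

Lemma is_derive_chain (V U W : normedModType R) (p : V -> U) (f : U -> W)
    x v p' : is_derive x v p p' -> differentiable f (p x) ->
  is_derive x v (f \o p) ('D_p' f (p x)).
Proof.
move=> /is_derive_line [/derivable1_diffP dp pE] df.
have p0 : p x = (fun t : R => p (t *: v + x)) 0 by rewrite scale0r add0r.
rewrite p0 in df *; apply/is_derive_line.
have dfp := differentiable_comp dp df.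
apply: DeriveDef; first exact/derivable1_diffP.
by rewrite (deriveE _ dfp) diff_comp //= (deriveE p' df) -pE (deriveE _ dp).
Qed.

Lemma derive_coords n (W : normedModType R) (f : 'rV[R]_n -> W) x v :
  differentiable f x -> 'D_v f x = \sum_i v 0 i *: 'D_(delta_mx 0 i) f x.
Proof.
move=> df; rewrite (deriveE _ df) [in LHS](row_sum_delta v) linear_sum.
by apply: eq_bigr => i _; rewrite linearZ (deriveE _ df).
Qed.

Lemma is_derive_mxP (V : normedModType R) m n (M : V -> 'M[R]_(m, n)) x v M' :
  is_derive x v M M' <-> forall i j, is_derive x v (fun y => M y i j) (M' i j).
Proof.
split=> [[dM <-] i j|dM].
  by rewrite derive_mx // mxE; apply: derivableP; exact: (derivable_mxP _ _ _).1.
have dM' : derivable M x v by apply/derivable_mxP => i j; have [] := dM i j.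
apply: DeriveDef => //; rewrite derive_mx //; apply/matrixP => i j.
by rewrite mxE; have [] := dM i j.
Qed.

Lemma is_derive_mul (V : normedModType R) (f g : V -> R) x v f' g' :
  is_derive x v f f' -> is_derive x v g g' ->
  is_derive x v (fun y => f y * g y) (f' * g x + f x * g').
Proof.
move=> df dg; have := is_deriveM df dg.
by rewrite addrC /GRing.scale /= [g x * _]mulrC.
Qed.

Lemma is_derive_bigsum (V W : normedModType R) n (F : 'I_n -> V -> W) x v F' :
  (forall i, is_derive x v (F i) (F' i)) ->
  is_derive x v (fun y => \sum_i F i y) (\sum_i F' i).
Proof.
move=> dF; rewrite (_ : (fun y => _) = \sum_i F i).
  by apply: is_derive_sum.
by apply/funext => y; rewrite fct_sumE.
Qed.

Lemma is_derive_mulmx (V : normedModType R) m n k (A : V -> 'M[R]_(m, n))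
    (B : V -> 'M[R]_(n, k)) x v A' B' :
  is_derive x v A A' -> is_derive x v B B' ->
  is_derive x v (fun y => A y *m B y) (A' *m B x + A x *m B').
Proof.
move=> /is_derive_mxP dA /is_derive_mxP dB; apply/is_derive_mxP => i j.
rewrite !mxE -big_split /=.
rewrite (_ : (fun y => _) = fun y => \sum_l A y i l * B y l j).
  by apply: is_derive_bigsum => l; apply: is_derive_mul.
by apply/funext => y; rewrite mxE.
Qed.

Lemma is_derive_tr (V : normedModType R) m n (A : V -> 'M[R]_(m, n)) x v A' :
  is_derive x v A A' -> is_derive x v (fun y => (A y)^T) A'^T.
Proof.
move=> /is_derive_mxP dA; apply/is_derive_mxP => i j; rewrite mxE.
by rewrite (_ : (fun y => _) = fun y => A y j i) //; apply/funext=> y; rewrite mxE.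
Qed.

Lemma is_derive_mx_scale (V : normedModType R) m n (r : V -> R)
    (A : V -> 'M[R]_(m, n)) x v r' A' :
  is_derive x v r r' -> is_derive x v A A' ->
  is_derive x v (fun y => r y *: A y) (r' *: A x + r x *: A').
Proof.
move=> dr /is_derive_mxP dA; apply/is_derive_mxP => i j; rewrite !mxE.
rewrite (_ : (fun y => _) = fun y => r y * A y i j); first exact: is_derive_mul.
by apply/funext=> y; rewrite mxE.
Qed.

Lemma is_derive_row_mx (V : normedModType R) m n k (A : V -> 'M[R]_(m, n))
    (B : V -> 'M[R]_(m, k)) x v A' B' :
  is_derive x v A A' -> is_derive x v B B' ->
  is_derive x v (fun y => row_mx (A y) (B y)) (row_mx A' B').
Proof.
move=> /is_derive_mxP dA /is_derive_mxP dB; apply/is_derive_mxP => i j.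
rewrite !mxE; case: split_ordP => l ->.
  rewrite (_ : (fun y => _) = fun y => A y i l) //.
  by apply/funext=> y; rewrite row_mxEl.
rewrite (_ : (fun y => _) = fun y => B y i l) //.
by apply/funext=> y; rewrite row_mxEr.
Qed.

(** What is known of the set of times at which a line issued from a point of a
    half-space lies in it. *)
Definition half_line (T : set R) : Prop :=
  (forall t, 0 <= t -> T t) \/ (forall t, t <= 0 -> T t).

Lemma half_line0 T : half_line T -> T 0.
Proof. by case; apply. Qed.

(** Hence limits along a half-line are unique. *)
Lemma half_line_proper T : half_line T -> ProperFilter (within T (0 : R)^').
Proof.
move=> hT; apply: Build_ProperFilter_ex => A.
rewrite /within /= /dnbhs /within /= => /nbhs_ballP[e /= e0 He].
have e20 : 0 < e / 2 by rewrite divr_gt0.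
have be : `|e / 2| < e by rewrite gtr0_norm // ltr_pdivrMr// ltr_pMr// ltr1n.
case: hT => h; [exists (e / 2)|exists (- (e / 2))]; apply: He.
- by rewrite /ball /= sub0r normrN.
- by rewrite gt_eqF.
- exact/h/ltW.
- by rewrite /ball /= sub0r normrN normrN.
- by rewrite oppr_eq0 gt_eqF.
- by apply: h; rewrite oppr_le0 ltW.
Qed.

Lemma half_line_cvg (W : normedModType R) T (f : R -> W) f' :
  is_derive (0 : R) 1 f f' ->
  (fun t : R => t^-1 *: (f t - f 0)) @ within T (0 : R)^' --> f'.
Proof.
move=> [df <-].
apply: (@cvg_trans _ ((fun t : R => t^-1 *: (f t - f 0)) @ 0^')).
  by apply: cvg_fmap2; apply: cvg_within.
have : (fun t : R => t^-1 *: (f (t *: 1 + 0) - f 0)) @ 0^' --> ('D_1 f 0 : W).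
  exact: df.
rewrite (_ : (fun t : R => _ *: (f (t *: 1 + 0) - f 0)) =
             (fun t : R => t^-1 *: (f t - f 0))) //.
by apply/funext => t /=; rewrite addr0 [_%:A]mulr1.
Qed.

Lemma is_derive_unique_half (W : normedModType R) (T : set R) (f g : R -> W)
    f' g' : half_line T ->
  is_derive (0 : R) 1 f f' -> is_derive (0 : R) 1 g g' ->
  (\forall t \near (0 : R), T t -> f t = g t) -> f' = g'.
Proof.
move=> hT /(half_line_cvg T) df /(half_line_cvg T) dg fg.
have pD := half_line_proper hT.
apply: (cvg_unique (@norm_hausdorff R W) df).
apply: cvg_trans dg; apply: near_eq_cvg.
have fg' : \forall t \near within T (0 : R)^', T t -> f t = g t.
  by apply: cvg_within; apply: nbhs_dnbhs.
apply: filterS2 fg' (withinT T (@dnbhs_filter _ (0 : R))) => t ft Tt.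
by rewrite (ft Tt) (nbhs_singleton fg (half_line0 hT)).
Qed.

End differential.

Section halfspace.
Context {R : realType} {n : nat}.
Implicit Types x w : 'rV[R]_n.

(** The sign of [w] along the normal coordinate decides which half-line stays
    inside; tangent directions stay in the boundary. *)
Lemma halfspace_line x w : halfspace x ->
  half_line [set t : R | halfspace (t *: w + x)].
Proof.
move=> hx; case: (pselect (forall i : 'I_n, i = 0%N :> nat -> 0 <= w 0 i)) => hw.
  left=> t t0 i i0; rewrite !mxE addr_ge0 //; last exact: hx.
  by rewrite mulr_ge0 // hw.
right=> t t0 i i0; rewrite !mxE addr_ge0 //; last exact: hx.
rewrite mulr_le0 // leNgt; apply/negP => wi; apply: hw => j j0.
by rewrite (_ : j = i) ?ltW //; apply: val_inj; rewrite /= i0 j0.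
Qed.

Lemma near_line (P : set 'rV[R]_n) x w : (\forall y \near x, P y) ->
  \forall t \near (0 : R), P (t *: w + x).
Proof.
have c : {for (0 : R), continuous (fun t : R => t *: w + x)}.
  apply: differentiable_continuous; apply: differentiableD => //.
by have := c P; rewrite /continuous_at scale0r add0r.
Qed.

(** Directions pointing outwards at the boundary are no exception: moving
    backwards in time along them leads into the half-space. *)
Lemma derive_halfspace (W : normedModType R) (f g : 'rV[R]_n -> W) x w f' g' :
  halfspace x -> is_derive x w f f' -> is_derive x w g g' ->
  (\forall y \near x, halfspace y -> f y = g y) -> f' = g'.
Proof.
move=> hx /is_derive_line df /is_derive_line dg fg.
apply: (is_derive_unique_half (halfspace_line w hx) df dg).
exact: near_line fg.
Qed.

Lemma hpartialE (f h : 'rV[R]_n -> R) i x : halfspace x ->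
  differentiable h x -> (\forall y \near x, halfspace y -> f y = h y) ->
  hpartial i f x = 'D_(delta_mx 0 i) h x.
Proof.
move=> hx dh fh; set w : 'rV[R]_n := delta_mx 0 i.
have /is_derive_line /(half_line_cvg [set t | halfspace (t *: w + x)]) :=
  is_derive_diff w dh.
rewrite /hpartial scale0r add0r.
set T := [set t | _].
rewrite (_ : (fun t : R => halfspace (x + t *: delta_mx 0 i)) = T); last first.
  by apply/funext => t; rewrite /T /= addrC.
move=> cv; have pD := half_line_proper (halfspace_line w hx).
apply: cvg_lim => //; apply: cvg_trans cv; apply: near_eq_cvg.
have fh' : \forall t \near within T (0 : R)^', T t -> f (t *: w + x) = h (t *: w + x).
  by apply: cvg_within; apply: nbhs_dnbhs; apply: near_line fh.
apply: filterS2 fh' (withinT T (@dnbhs_filter _ (0 : R))) => t ft Tt.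
by rewrite [x + _]addrC (ft Tt) (nbhs_singleton fh hx).
Qed.

End halfspace.

(** * Smooth functions *)

Section smooth.
Context {R : realType}.
Implicit Types n m k : nat.

Lemma differentiable_row (V : normedModType R) n (p : V -> 'rV[R]_n) x :
  (forall j, differentiable (fun y => p y 0 j) x) -> differentiable p x.
Proof.
move=> dp; rewrite (_ : p = \sum_j (fun y => p y 0 j *: delta_mx 0 j)).
  by apply: differentiable_sum => j; apply: differentiableZl; apply: dp.
by apply/funext => y; rewrite fct_sumE [LHS]row_sum_delta.
Qed.

(** Smoothness up to a finite order, so that the stability of smooth functions
    under the usual operations is proved by induction on the order. *)
Definition smooth_upto k n (W : set 'rV[R]_n) (f : 'rV[R]_n -> R) : Prop :=
  forall s x, (size s <= k)%N -> W x -> differentiable (partials s f) x.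

Lemma smooth_openE n (W : set 'rV[R]_n) f :
  smooth_open W f <-> forall k, smooth_upto k W f.
Proof. by split=> [h k s x _|h s x]; [apply: h|apply: (h (size s))]. Qed.

Lemma smooth_uptoS k n (W : set 'rV[R]_n) f :
  smooth_upto k.+1 W f <-> (forall x, W x -> differentiable f x) /\
    forall i, smooth_upto k W ('D_(delta_mx 0 i) f).
Proof.
split=> [h|[h1 h2] s x].
  split=> [x Wx|i s x sk Wx]; first exact: (h [::]).
  by have := h (rcons s i) x; rewrite /partials foldr_rcons size_rcons; apply.
case/lastP: s => [|s i]; first by move=> _; apply: h1.
by rewrite /partials foldr_rcons size_rcons; apply: h2.
Qed.

Lemma smooth_upto_diff k n (W : set 'rV[R]_n) f x :
  smooth_upto k W f -> W x -> differentiable f x.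
Proof. by move=> h; apply: (h [::]). Qed.

Lemma smooth_uptoW k n (W : set 'rV[R]_n) f :
  smooth_upto k.+1 W f -> smooth_upto k W f.
Proof. by move=> h s x sk; apply: h; apply: leqW. Qed.

Lemma smooth_uptoSW k n (W V : set 'rV[R]_n) f :
  V `<=` W -> smooth_upto k W f -> smooth_upto k V f.
Proof. by move=> VW h s x sk /VW; apply: h. Qed.

Lemma smooth_upto_eq k n (W : set 'rV[R]_n) f g : open W ->
  (forall x, W x -> f x = g x) -> smooth_upto k W f -> smooth_upto k W g.
Proof.
move=> oW fg sf s x sk Wx.
have nW y : W y -> \forall z \near y, W z by move=> Wy; apply: open_nbhs_nbhs.
have E y : W y -> partials s f y = partials s g y.
  elim: s {sk} y => [|i s IH] y Wy /=; first exact: fg.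
  apply: near_eq_derive; near=> z; apply: IH.
  by near: z; apply: nW.
apply: near_eq_differentiable (sf s x sk Wx); near=> z; apply: E.
by near: z; apply: nW.
Unshelve. all: by end_near. Qed.

Lemma smooth_upto_cst k n (W : set 'rV[R]_n) (c : R) :
  smooth_upto k W (fun=> c).
Proof.
elim: k c => [|k IH] c; first by move=> [|//] x _ _; apply: differentiable_cst.
apply/smooth_uptoS; split=> [x _|i]; first exact: differentiable_cst.
rewrite (_ : 'D_(delta_mx 0 i) _ = fun=> 0) //.
by apply/funext => x; apply: (derive_cst c).
Qed.

Lemma smooth_upto_coord k n (W : set 'rV[R]_n) j :
  smooth_upto k W (fun x => x 0 j).
Proof.
case: k => [|k]; first by move=> [|//] x _ _; apply: differentiable_coord.
apply/smooth_uptoS; split=> [x _|i]; first exact: differentiable_coord.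
rewrite (_ : 'D_(delta_mx 0 i) _ = fun=> (delta_mx 0 i : 'rV[R]_n) 0 j).
  exact: smooth_upto_cst.
apply/funext => x.
by have [_ <-] := (is_derive_mxP _ _ _ _).1 (is_derive_id x (delta_mx 0 i)) 0 j.
Qed.

Lemma smooth_uptoD k n (W : set 'rV[R]_n) f g : open W ->
  smooth_upto k W f -> smooth_upto k W g ->
  smooth_upto k W (fun x => f x + g x).
Proof.
move=> oW; elim: k f g => [|k IH] f g sf sg.
  move=> [|//] x _ Wx; apply: differentiableD.
    exact: smooth_upto_diff sf Wx.
  exact: smooth_upto_diff sg Wx.
apply/smooth_uptoS; split=> [x Wx|i].
  apply: differentiableD; first exact: smooth_upto_diff sf Wx.
  exact: smooth_upto_diff sg Wx.
have /smooth_uptoS [df sf'] := sf; have /smooth_uptoS [dg sg'] := sg.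
apply: (smooth_upto_eq oW _ (IH _ _ (sf' i) (sg' i))) => x Wx.
by apply/esym; apply: deriveD; apply: diff_derivable; [apply: df|apply: dg].
Qed.

Lemma smooth_uptoM k n (W : set 'rV[R]_n) f g : open W ->
  smooth_upto k W f -> smooth_upto k W g ->
  smooth_upto k W (fun x => f x * g x).
Proof.
move=> oW; elim: k f g => [|k IH] f g sf sg.
  move=> [|//] x _ Wx; apply: differentiableM.
    exact: smooth_upto_diff sf Wx.
  exact: smooth_upto_diff sg Wx.
apply/smooth_uptoS; split=> [x Wx|i].
  apply: differentiableM; first exact: smooth_upto_diff sf Wx.
  exact: smooth_upto_diff sg Wx.
have /smooth_uptoS [df sf'] := sf; have /smooth_uptoS [dg sg'] := sg.
have := smooth_uptoD oW (IH _ _ (sf' i) (smooth_uptoW sg))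
                        (IH _ _ (smooth_uptoW sf) (sg' i)).
apply: smooth_upto_eq => // x Wx; apply/esym/derive_val.
by apply: is_derive_mul; apply: is_derive_diff; [apply: df|apply: dg].
Qed.

Lemma smooth_upto_sum k n m (W : set 'rV[R]_n) (F : 'I_m -> 'rV[R]_n -> R) :
  open W -> (forall i, smooth_upto k W (F i)) ->
  smooth_upto k W (fun x => \sum_i F i x).
Proof.
move=> oW; elim: m F => [|m IH] F sF.
  have := @smooth_upto_cst k n W 0; apply: smooth_upto_eq => // x _.
  by rewrite big_ord0.
have := smooth_uptoD oW (sF ord0) (IH _ (fun i => sF (lift ord0 i))).
by apply: smooth_upto_eq => // x _; rewrite big_ord_recl.
Qed.

(** By the chain rule, the partial derivatives of [f \o p] are sums of products
    of [('D_j f) \o p], to which induction applies, and derivatives of [p]. *)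
Lemma smooth_upto_comp k m n (W : set 'rV[R]_m) (W' : set 'rV[R]_n)
    (p : 'rV[R]_m -> 'rV[R]_n) f : open W ->
  (forall j, smooth_upto k W (fun x => p x 0 j)) ->
  (forall x, W x -> W' (p x)) -> smooth_upto k W' f ->
  smooth_upto k W (f \o p).
Proof.
move=> oW; elim: k p f => [|k IH] p f sp pW sf.
all: have dp x : W x -> differentiable p x by
  move=> Wx; apply: differentiable_row => j; exact: smooth_upto_diff (sp j) Wx.
all: have df x : W x -> differentiable f (p x) by
  move=> /pW; exact: smooth_upto_diff sf.
all: have dfp x (Wx : W x) := differentiable_comp (dp x Wx) (df x Wx).
  by move=> [|//] x _; apply: dfp.
apply/smooth_uptoS; split=> // i.
have /smooth_uptoS [_ sf'] := sf.
have sp' j : smooth_upto k W ('D_(delta_mx 0 i) (fun x => p x 0 j)).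
  by have /smooth_uptoS [_] := sp j.
have H j := smooth_uptoM oW (sp' j)
  (IH p _ (fun j => smooth_uptoW (sp j)) pW (sf' j)).
apply: smooth_upto_eq (smooth_upto_sum oW H) => // x Wx.
have /(is_derive_diff (delta_mx 0 i)) dpx := dp x Wx.
rewrite (@derive_val _ _ _ _ _ _ _ (is_derive_chain dpx (df x Wx))).
rewrite derive_coords; last exact: df.
apply: eq_bigr => j _; congr (_ * _).
by have /is_derive_mxP /(_ 0 j) [_ <-] := dpx.
Qed.

(** Inverse square root; its derivative is a polynomial in itself, which makes
    its composites with smooth positive functions visibly smooth. *)
Definition rsqrt (t : R) : R := (Num.sqrt t)^-1.

Lemma rsqrt1 : rsqrt 1 = 1.
Proof. by rewrite /rsqrt sqrtr1 invr1. Qed.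

Lemma rsqrt_sqr t : 0 < t -> rsqrt t ^+ 2 * t = 1.
Proof.
by move=> t0; rewrite /rsqrt exprVn sqr_sqrtr ?ltW // mulVf // gt_eqF.
Qed.

Lemma is_derive_rsqrt (t : R) : 0 < t ->
  is_derive t 1 rsqrt (- 2^-1 * rsqrt t ^+ 3).
Proof.
move=> t0; have s0 : Num.sqrt t != 0 by rewrite gt_eqF // sqrtr_gt0.
have H := is_derive1_sqrt t0.
have [dV VE] : is_derive t 1 (fun u => (Num.sqrt u)^-1)
    (- (Num.sqrt t) ^- 2 *: (2 * Num.sqrt t)^-1).
  apply: DeriveDef; first by apply: derivableV => //; case: H.
  by rewrite deriveV //; case: H => // _ ->.
apply: DeriveDef => //; rewrite VE /GRing.scale /= /rsqrt.
by field; rewrite s0.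
Qed.

Lemma is_derive_comp_rsqrt (V : normedModType R) (f : V -> R) x v f' :
  0 < f x -> is_derive x v f f' ->
  is_derive x v (rsqrt \o f) (f' * (- 2^-1 * rsqrt (f x) ^+ 3)).
Proof.
move=> fx /is_derive_chain df; have dr := is_derive_rsqrt fx.
have dr' : differentiable rsqrt (f x) by apply/derivable1_diffP; case: dr.
have := df _ _ dr'; rewrite deriveE // -[X in 'd _ _ X]mulr1 linearZ /=.
by rewrite -deriveE // (@derive_val _ _ _ _ _ _ _ dr).
Qed.

Lemma smooth_upto_rsqrt k n (W : set 'rV[R]_n) f : open W ->
  (forall x, W x -> 0 < f x) -> smooth_upto k W f ->
  smooth_upto k W (rsqrt \o f).
Proof.
move=> oW f0; elim: k => [|k IH] sf.
all: have dr x : W x -> differentiable (rsqrt \o f) x by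
  move=> Wx; apply: differentiable_comp; [exact: smooth_upto_diff sf Wx|];
  apply/derivable1_diffP; case: (is_derive_rsqrt (f0 x Wx)).
  by move=> [|//] x _; apply: dr.
apply/smooth_uptoS; split=> // i.
have /smooth_uptoS [df sf'] := sf; have {}IH := IH (smooth_uptoW sf).
have H := smooth_uptoM oW (sf' i) (smooth_uptoM oW (@smooth_upto_cst k n W (- 2^-1))
  (smooth_uptoM oW IH (smooth_uptoM oW IH IH))).
apply: smooth_upto_eq H => // x Wx; apply/esym.
have dfx := is_derive_diff (delta_mx 0 i) (df x Wx).
rewrite (@derive_val _ _ _ _ _ _ _ (is_derive_comp_rsqrt (f0 x Wx) dfx)) /=.
by rewrite exprS expr2.
Qed.

End smooth.

(** * Symmetry of second derivatives *)

Section schwarz.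
Context {R : realType}.

Lemma is_derive_affine (V : normedModType R) (a z : V) (t : R) :
  is_derive t 1 (fun u : R => u *: a + z) a.
Proof.
have dp : differentiable (fun u : R => u *: a + z) t.
  by apply: differentiableD.
apply: DeriveDef; first exact/derivable1_diffP.
have H : is_diff t ( *:%R^~ a + cst z : R -> V) ( *:%R^~ a + 0).
  by apply: is_diffD.
rewrite deriveE // (_ : (fun u : R => _) = *:%R^~ a + cst z) //.
by rewrite (@diff_val _ _ _ _ _ _ _ H) !fctE addr0 scale1r.
Qed.

Lemma is_derive_along (V W : normedModType R) (f : V -> W) (a z : V) (t : R) :
  differentiable f (t *: a + z) ->
  is_derive t 1 (fun u : R => f (u *: a + z)) ('D_a f (t *: a + z)).
Proof. by move=> df; exact: (is_derive_chain (is_derive_affine a z t) df). Qed.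

Lemma MVT_along (V : normedModType R) (f : V -> R) (a z : V) (s : R) :
  0 < s -> (forall t, 0 <= t <= s -> differentiable f (t *: a + z)) ->
  exists2 t, 0 <= t <= s & f (s *: a + z) - f z = s * 'D_a f (t *: a + z).
Proof.
move=> s0 df.
have dg t : 0 <= t <= s -> is_derive t 1 (fun u : R => f (u *: a + z))
    ('D_a f (t *: a + z)) by move=> /df; exact: is_derive_along.
have [| |t ts] := MVT s0 (f := fun u : R => f (u *: a + z))
    (df := fun t => 'D_a f (t *: a + z)).
- move=> t /itvP ts; apply: dg; by rewrite !ts.
- apply: derivable_within_continuous => t /itvP ts.
  by have /dg[] : 0 <= t <= s by rewrite !ts.
rewrite scale0r add0r subr0 mulrC => ->; exists t => //; rewrite !(itvP ts) //.
Qed.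

(** The mean value theorem is applied first in the direction [a], to the
    difference of [f] along [s *: b], then to ['D_a f] in the direction [b]. *)
Lemma second_difference (V : normedModType R) (f : V -> R) (a b x : V)
    (U : set V) : nbhs x U ->
  (forall y, U y -> differentiable f y /\ differentiable ('D_a f) y) ->
  \forall s \near (0 : R)^'+, exists2 y, U y &
    f (s *: a + (s *: b + x)) - f (s *: a + x) - (f (s *: b + x) - f x) =
      s ^+ 2 * 'D_b ('D_a f) y.
Proof.
move=> /nbhs_ballP[e /= e0 eU] df.
have U' t r s : 0 <= t <= s -> 0 <= r <= s -> s * (`|a| + `|b|) < e ->
    U (t *: a + (r *: b + x)).
  move=> /andP[t0 ts] /andP[r0 rs] se; apply: eU.
  rewrite -ball_normE /= addrA distrC addrK (le_lt_trans (ler_normD _ _)) //.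
  rewrite !normrZ !ger0_norm // (le_lt_trans _ se) // mulrDr.
  by rewrite lerD // ler_wpM2r.
near=> s.
have s0 : 0 < s by near: s; apply: nbhs_right_gt.
have ss : 0 <= s <= s by rewrite lexx ltW.
have s00 : 0 <= (0 : R) <= s by rewrite lexx ltW.
have se : s * (`|a| + `|b|) < e.
  have ab : 0 < `|a| + `|b| + 1 by rewrite ltr_wpDl.
  apply: (@le_lt_trans _ _ (s * (`|a| + `|b| + 1))).
    by rewrite ler_wpM2l ?lerDl // ltW.
  by rewrite -ltr_pdivlMr //; near: s; apply: nbhs_right_lt; rewrite divr_gt0.
have U0 t : 0 <= t <= s -> U (t *: a + x).
  by move=> ts; have := U' t 0 s ts s00 se; rewrite scale0r add0r.
pose g z := f (s *: b + z) - f z.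
have dg t : 0 <= t <= s ->
    differentiable (fun z => f (s *: b + z)) (t *: a + x) /\
    is_derive (t *: a + x) a g ('D_a f (s *: b + (t *: a + x)) - 'D_a f (t *: a + x)).
  move=> ts.
  have dsh : differentiable (fun z => s *: b + z) (t *: a + x).
    by apply: differentiableD.
  have Uy : U (s *: b + (t *: a + x)).
    by rewrite addrCA; apply: U' ts ss se.
  have d1 : differentiable (fun z => f (s *: b + z)) (t *: a + x).
    by apply: (differentiable_comp dsh); case: (df _ Uy).
  split=> //; apply: is_deriveB; last first.
    by apply: is_derive_diff; case: (df _ (U0 _ ts)).
  have /is_derive_chain H : is_derive (t *: a + x) a (fun z => s *: b + z) a.
    by have := is_deriveD (is_derive_cst (s *: b) (t *: a + x) a)
      (is_derive_id (t *: a + x) a); rewrite add0r.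
  by apply: H; case: (df _ Uy).
have [t ts E1] := MVT_along (a := a) (f := g) (z := x) s0 (fun t ts =>
  differentiableB (dg t ts).1 (df _ (U0 _ ts)).1).
have [r rs E2] := MVT_along (f := 'D_a f) (a := b) (z := t *: a + x) s0 (fun r rs =>
  (df (r *: b + (t *: a + x))
     (eq_ind _ U (U' t r s ts rs se) _ (addrCA _ _ _))).2).
exists (r *: b + (t *: a + x)); first by rewrite addrCA; apply: U' ts rs se.
have [_ [_ E3]] := dg t ts.
by move: E1; rewrite E3 E2 mulrA -expr2 /g => <-; rewrite [s *: a + (_ + x)]addrCA.
Unshelve. all: by end_near. Qed.

Lemma eq_of_near_values (V : normedModType R) (A B : V -> R) (x : V) :
  {for x, continuous A} -> {for x, continuous B} ->
  (forall U, nbhs x U -> exists y z, [/\ U y, U z & A y = B z]) -> A x = B x.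
Proof.
move=> cA cB AB; apply/eqP/contraT => ne.
have e0 : 0 < `|A x - B x| / 2 by rewrite divr_gt0 // normr_gt0 subr_eq0.
have [y [z [[/= yA _] [_ /= zB] E]]] := AB _
  (filterI ((cvgrPdist_lt _ _).1 cA _ e0) ((cvgrPdist_lt _ _).1 cB _ e0)).
have : `|A x - B x| < `|A x - B x|.
  apply: le_lt_trans (ler_distD (A y) _ _) _; rewrite [ltRHS]splitr.
  by apply: ltrD yA _; rewrite E distrC.
by rewrite ltxx.
Qed.

(** The second difference is symmetric in [a] and [b], so that both iterated
    derivatives take a common value arbitrarily close to [x]. *)
Lemma derive_sym (V : normedModType R) (f : V -> R) (a b x : V) (W : set V) :
  nbhs x W ->
  (forall y, W y -> [/\ differentiable f y, differentiable ('D_a f) y &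
                        differentiable ('D_b f) y]) ->
  {for x, continuous ('D_b ('D_a f))} -> {for x, continuous ('D_a ('D_b f))} ->
  'D_b ('D_a f) x = 'D_a ('D_b f) x.
Proof.
move=> xW df cA cB; apply: eq_of_near_values cA cB _ => U xU.
have xUW : nbhs x (U `&` W) by exact: filterI.
have H1 := second_difference b xUW
  (fun y Uy => let: And3 d1 d2 d3 := df y Uy.2 in conj d1 d2).
have H2 := second_difference a xUW
  (fun y Uy => let: And3 d1 d2 d3 := df y Uy.2 in conj d1 d3).
have H3 : \forall s \near (0 : R)^'+, 0 < s by exact: nbhs_right_gt.
have [s [[[y [Uy _] E1] [z [Uz _] E2]] s0]] :=
  filter_ex (filterI (filterI H1 H2) H3).
exists y, z; split; [exact: Uy|exact: Uz|apply: (@mulfI _ (s ^+ 2))].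
  by rewrite expf_neq0 // gt_eqF.
apply: etrans (etrans (esym E1) _) E2.
by rewrite [s *: b + (s *: a + x)]addrCA !opprB addrACA [- _ - _]addrC addrACA.
Qed.

Lemma smooth_derive_sym n (f : 'rV[R]_n -> R) (W : set 'rV[R]_n) x i j :
  open W -> W x -> smooth_open W f ->
  'D_(delta_mx 0 i) ('D_(delta_mx 0 j) f) x =
  'D_(delta_mx 0 j) ('D_(delta_mx 0 i) f) x.
Proof.
move=> oW Wx sf; apply: (derive_sym (W := W)).
- exact: open_nbhs_nbhs.
- by move=> y Wy; split; [apply: (sf [::])|apply: (sf [:: j])|apply: (sf [:: i])].
- by apply: differentiable_continuous; apply: (sf [:: i; j]).
- by apply: differentiable_continuous; apply: (sf [:: j; i]).
Qed.

End schwarz.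

(** * Charts, changes of charts and tangent vectors *)

Section local_extension.
Context {R : realType} {n : nat}.

Lemma smooth_openW (W V : set 'rV[R]_n) f :
  V `<=` W -> smooth_open W f -> smooth_open V f.
Proof. by move=> VW sf s x /VW; apply: sf. Qed.

Lemma smooth_on_family (I : finType) (A : set 'rV[R]_n)
    (f : I -> 'rV[R]_n -> R) x : (forall i, smooth_on A (f i)) -> A x ->
  exists W h, [/\ open W, W x, forall i, smooth_open W (h i) &
    forall i y, A y -> W y -> h i y = f i y].
Proof.
move=> sf Ax.
have /choice[F FP] i : exists Wh : set 'rV[R]_n * ('rV[R]_n -> R),
    [/\ open Wh.1, Wh.1 x, smooth_open Wh.1 Wh.2 &
      forall y, A y -> Wh.1 y -> Wh.2 y = f i y].
  by have [W [h hP]] := sf i x Ax; exists (W, h).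
have nx : \forall y \near x, forall i, (F i).1 y.
  have nF i : \forall y \near x, (F i).1 y.
    by have [oW Wx _ _] := FP i; apply: open_nbhs_nbhs.
  exact: filter_forall nF.
have sW i : ([set y | forall i, (F i).1 y]° `<=` (F i).1).
  by move=> y /interior_subset; apply.
exists ([set y | forall i, (F i).1 y]°), (fun i => (F i).2).
split=> //; first exact: open_interior.
  by move=> i; have [_ _ sm _] := FP i; apply: smooth_openW (sW i) sm.
by move=> i y Ay /(sW i); have [_ _ _] := FP i; apply.
Qed.

End local_extension.

Section charts.
Context {R : realType} {n : nat} {M : manifold R n}.
Implicit Types (c : chart R n M) (p q : M).

Lemma chart_inj c p q : cdom c p -> cdom c q -> c p = c q -> p = q.
Proof. by move=> cp cq E; rewrite -(cfunK cp) E cfunK. Qed.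

Lemma chart_halfspace c p : cdom c p -> halfspace (c p).
Proof.
move=> cp; have [V _ E] := cimg_open c.
by have : (cfun c @` cdom c) (c p) by [exists p]; rewrite E => -[].
Qed.

Lemma chart_continuous c p : cdom c p -> {for p, continuous c}.
Proof.
move=> cp; have := cfun_continuous (c := c).
rewrite continuous_open_subspace; last exact: cdom_open.
by apply; rewrite inE.
Qed.

(** By continuity of the inverse chart; this trades neighbourhoods in the manifold
    for neighbourhoods in the half-space. *)
Lemma near_chart c p (U : set M) : cdom c p -> nbhs p U ->
  \forall y \near c p, halfspace y ->
    exists q, [/\ cdom c q, U q & c q = y].
Proof.
move=> cp pU; have [V oV E] := cimg_open c.
have cAp : (cfun c @` cdom c) (c p) by exists p.
have Vp : V (c p) by have := cAp; rewrite E => -[].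
have /subspace_continuousP /(_ _ cAp) := cinv_continuous (c := c).
rewrite /from_subspace cfunK // => /(_ _ pU) /= ci.
have nV : \forall y \near c p, V y by apply: open_nbhs_nbhs.
move: ci; rewrite /within /= => ci.
apply: filterS2 nV ci => y Vy Uy hy.
have [q cq qy] : (cfun c @` cdom c) y by rewrite E.
exists q; split=> //; rewrite -(cfunK cq) qy; apply: Uy.
by exists q.
Qed.

Lemma near_cdom c p : cdom c p -> nbhs p (cdom c).
Proof. by move=> cp; apply: open_nbhs_nbhs; split=> //; apply: cdom_open. Qed.

(** Besides extending the change of charts, this records that the points of [W]
    in the half-space come from both charts. *)
Definition trans_ext c c' (W : set 'rV[R]_n) (phi : 'rV[R]_n -> 'rV[R]_n) :=
  [/\ open W, forall j, smooth_open W (fun y => phi y 0 j) &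
    forall y, W y -> halfspace y ->
      exists q, [/\ cdom c q, cdom c' q, c q = y & c' q = phi y]].

Lemma trans_extP c c' p : atlas c -> atlas c' -> cdom c p -> cdom c' p ->
  exists W phi, trans_ext c c' W phi /\ W (c p).
Proof.
move=> ac ac' cp c'p.
have Ap : (c @` (cdom c `&` cdom c')) (c p) by exists p.
have [W [h [oW Wp sh hE]]] := smooth_on_family (atlas_smooth ac ac') Ap.
have nA : \forall y \near c p, halfspace y -> (c @` (cdom c `&` cdom c')) y.
  apply: filterS (near_chart cp (near_cdom c'p)) => y H /H[q [cq c'q <-]].
  by exists q.
pose V := [set y | W y /\ (halfspace y -> (c @` (cdom c `&` cdom c')) y)]°.
have VW : V `<=` W by move=> y /interior_subset[].
exists V, (fun y => \row_j h j y); split; last first.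
  by apply: filterI nA; apply: open_nbhs_nbhs.
split=> [|j|y]; first exact: open_interior.
  have := smooth_openW VW (sh j); rewrite (_ : (fun y => _) = h j) //.
  by apply/funext => y; rewrite mxE.
move=> /interior_subset[Wy Ay] hy; have [q [cq c'q] qy] := Ay hy.
exists q; split=> //; apply/rowP => j; rewrite mxE hE //; last exact: Ay.
by rewrite -qy cfunK.
Qed.

Definition jacobian_mx (phi : 'rV[R]_n -> 'rV[R]_n) (x : 'rV[R]_n) : 'M[R]_n :=
  \matrix_(i, j) 'D_(delta_mx 0 i) (fun y => phi y 0 j) x.

Lemma is_derive_trans c c' W phi x w : trans_ext c c' W phi -> W x ->
  is_derive x w phi (w *m jacobian_mx phi x).
Proof.
move=> [_ sp _] Wx.
have dp j : differentiable (fun y => phi y 0 j) x by apply: (sp j [::]).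
apply/is_derive_mxP => i j; rewrite ord1 mxE.
have := is_derive_diff w (dp j); rewrite derive_coords //.
under eq_bigr do rewrite [_ *: _]/(_ * _).
by under [in X in _ -> X]eq_bigr do rewrite mxE.
Qed.

Lemma trans_ext_near c c' W phi y : trans_ext c c' W phi -> W y ->
  \forall z \near y, W z.
Proof. by move=> [oW _ _] Wy; apply: open_nbhs_nbhs. Qed.

Lemma trans_ext_continuous c c' W phi y : trans_ext c c' W phi -> W y ->
  {for y, continuous phi}.
Proof.
move=> [_ sp _] Wy; apply: differentiable_continuous.
by apply: differentiable_row => j; apply: (sp j [::]).
Qed.

Lemma trans_extE c c' W phi q : trans_ext c c' W phi ->
  cdom c q -> W (c q) -> cdom c' q /\ phi (c q) = c' q.
Proof.
move=> [_ _ H] cq Wq; have [r [cr c'r rq <-]] := H _ Wq (chart_halfspace cq).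
by rewrite (chart_inj cq cr (esym rq)).
Qed.

Lemma jacE c c' W phi q : trans_ext c c' W phi -> cdom c q -> W (c q) ->
  jac c c' (c q) = jacobian_mx phi (c q).
Proof.
move=> te cq Wq; have [oW sp H] := te; apply/matrixP => i j; rewrite !mxE.
apply: hpartialE; [exact: chart_halfspace|exact: (sp j [::])|].
apply: filterS (trans_ext_near te Wq) => y Wy hy.
by have [r [cr c'r <- <-]] := H y Wy hy; rewrite cfunK.
Qed.

Lemma mulmx_delta_eq m k (A B : 'M[R]_(m, k)) :
  (forall i, delta_mx (0 : 'I_1) i *m A = delta_mx 0 i *m B) -> A = B.
Proof. by move=> H; apply/row_matrixP => i; rewrite !rowE. Qed.

Lemma jac_id c p : atlas c -> cdom c p -> jac c c (c p) = 1%:M.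
Proof.
move=> ac cp; have [W [phi [te Wp]]] := trans_extP ac ac cp cp.
rewrite (jacE te cp Wp); apply: mulmx_delta_eq => i; rewrite mulmx1.
apply: (derive_halfspace (chart_halfspace cp) (is_derive_trans _ te Wp)
  (is_derive_id _ _)).
apply: filterS (trans_ext_near te Wp) => y Wy hy.
by have [_ _ H] := te; have [r [_ _ <- <-]] := H y Wy hy.
Qed.

(** The composite of two extended changes of charts extends the third one, at
    least in the half-space, which suffices by [derive_halfspace]. *)
Lemma jac_comp c c' c'' p : atlas c -> atlas c' -> atlas c'' ->
  cdom c p -> cdom c' p -> cdom c'' p ->
  jac c c'' (c p) = jac c c' (c p) *m jac c' c'' (c' p).
Proof.
move=> ac ac' ac'' cp c'p c''p.
have [W1 [f1 [te1 W1p]]] := trans_extP ac ac' cp c'p.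
have [W2 [f2 [te2 W2p]]] := trans_extP ac' ac'' c'p c''p.
have [W3 [f3 [te3 W3p]]] := trans_extP ac ac'' cp c''p.
have [_ f1p] := trans_extE te1 cp W1p.
rewrite (jacE te1 cp W1p) (jacE te2 c'p W2p) (jacE te3 cp W3p).
apply: mulmx_delta_eq => i; rewrite mulmxA.
have d1 := is_derive_trans (delta_mx 0 i) te1 W1p.
have d2 : is_derive (c p) (delta_mx 0 i) (f2 \o f1)
    (delta_mx 0 i *m jacobian_mx f1 (c p) *m jacobian_mx f2 (c' p)).
  have df2 : differentiable f2 (f1 (c p)).
    rewrite f1p; apply: differentiable_row => j.
    by have [_ sp _] := te2; apply: (sp j [::]).
  have := is_derive_chain d1 df2.
  set w := delta_mx 0 i *m _; rewrite f1p.
  by have [_ ->] := is_derive_trans w te2 W2p.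
apply: (derive_halfspace (chart_halfspace cp) (is_derive_trans _ te3 W3p) d2).
have n2 : \forall y \near c p, W2 (f1 y).
  apply: (trans_ext_continuous te1 W1p) => /=; rewrite f1p.
  exact: trans_ext_near te2 W2p.
near=> y => hy.
have W1y : W1 y by near: y; apply: trans_ext_near te1 W1p.
have W2y : W2 (f1 y) by near: y.
have W3y : W3 y by near: y; apply: trans_ext_near te3 W3p.
have [_ _ H1] := te1; have [q [cq c'q qy f1q]] := H1 y W1y hy.
rewrite -f1q in W2y; rewrite -qy in W3y.
rewrite /= -f1q -qy (trans_extE te2 c'q W2y).2.
by rewrite (trans_extE te3 cq W3y).2.
Unshelve. all: by end_near. Qed.

Lemma jac_unit c c' p : atlas c -> atlas c' -> cdom c p -> cdom c' p ->
  jac c c' (c p) *m jac c' c (c' p) = 1%:M.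
Proof. by move=> *; rewrite -jac_comp // jac_id. Qed.

(** The components in the other charts are forced; the chain rule makes them
    compatible. *)
Lemma exists_tangent c p (v : 'rV[R]_n) : atlas c -> cdom c p ->
  exists u : tangent M, base u = p /\ comp u c = v.
Proof.
move=> ac cp.
pose k c' := if pselect (atlas c' /\ cdom c' p) then v *m jac c c' (c p) else 0.
have kE c' : atlas c' -> cdom c' p -> k c' = v *m jac c c' (c p).
  by rewrite /k; case: pselect => // H a b; case: H.
have k_out c' : ~ (atlas c' /\ cdom c' p) -> k c' = 0.
  by rewrite /k; case: pselect.
have k_change c1 c2 : atlas c1 -> atlas c2 -> cdom c1 p -> cdom c2 p ->
    k c2 = k c1 *m jac c1 c2 (c1 p).
  by move=> a1 a2 p1 p2; rewrite !kE // -mulmxA -jac_comp.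
by exists (Tangent k_out k_change); split=> //=; rewrite kE // jac_id // mulmx1.
Qed.

End charts.

(** * Metrics and Koszul's formula *)

Section bilinear.
Context {R : realType} {n : nat}.
Implicit Types (A B : 'M[R]_n) (a b v w : 'rV[R]_n).

Definition bil A a b : R := (a *m A *m b^T) 0 0.

Lemma bilDl A a b v : bil A (a + b) v = bil A a v + bil A b v.
Proof. by rewrite /bil !mulmxDl mxE. Qed.

Lemma bilNl A a v : bil A (- a) v = - bil A a v.
Proof. by rewrite /bil !mulNmx mxE. Qed.

Lemma bilZl A k a v : bil A (k *: a) v = k * bil A a v.
Proof. by rewrite /bil -!scalemxAl mxE. Qed.

Lemma bilZr A k a v : bil A v (k *: a) = k * bil A v a.
Proof. by rewrite /bil linearZ /= -scalemxAr mxE. Qed.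

Lemma bil_addmx A B a b : bil (A + B) a b = bil A a b + bil B a b.
Proof. by rewrite /bil mulmxDr mulmxDl mxE. Qed.

Lemma bil_sym A a b : A^T = A -> bil A a b = bil A b a.
Proof.
move=> sA; rewrite /bil.
by rewrite -[in LHS](trmxK (a *m A *m b^T)) mxE !trmx_mul trmxK sA mulmxA.
Qed.

Lemma bil_congr B A C a b : bil (B *m A *m C^T) a b = bil A (a *m B) (b *m C).
Proof. by rewrite /bil trmx_mul !mulmxA. Qed.

Lemma bilE A a b : bil A a b = \sum_i \sum_j a 0 i * A i j * b 0 j.
Proof.
rewrite /bil mxE exchange_big; apply: eq_bigr => j _.
by rewrite !mxE mulr_suml.
Qed.

End bilinear.

Section metric_geometry.
Context {R : realType} {n : nat} {M : manifold R n} (g : metric M).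
Implicit Types (c : chart R n M) (p q : M) (v w z : 'rV[R]_n).

Lemma gmx_symE c p : atlas c -> cdom c p ->
  (gmx g c (c p))^T = gmx g c (c p).
Proof. by move=> ac cp; apply: gmx_sym => //; exists p. Qed.

Lemma gmx_gt0 c p v : atlas c -> cdom c p -> v != 0 ->
  0 < bil (gmx g c (c p)) v v.
Proof. by move=> ac cp; apply: gmx_posdef => //; exists p. Qed.

Lemma gmx_unit c p : atlas c -> cdom c p -> gmx g c (c p) \in unitmx.
Proof.
move=> ac cp; rewrite -row_free_unit -kermx_eq0; apply: contraT.
move=> /rowV0Pn[v /sub_kermxP vA v0].
by have := gmx_gt0 ac cp v0; rewrite /bil vA mul0mx mxE ltxx.
Qed.

Lemma comp_norm_invariant (u : tangent M) c c' : atlas c -> atlas c' ->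
  cdom c (base u) -> cdom c' (base u) ->
  bil (gmx g c (c (base u))) (comp u c) (comp u c) =
  bil (gmx g c' (c' (base u))) (comp u c') (comp u c').
Proof.
move=> ac ac' cu c'u; rewrite (comp_change ac ac') //.
by rewrite -bil_congr -gmx_change.
Qed.

Definition metric_ext c (W : set 'rV[R]_n) (G : 'rV[R]_n -> 'M[R]_n) :=
  [/\ open W, forall i j, smooth_open W (fun y => G y i j) &
    forall y, W y -> halfspace y -> exists2 q, cdom c q & c q = y /\
      gmx g c y = G y].

Lemma metric_extP c p : atlas c -> cdom c p ->
  exists W G, metric_ext c W G /\ W (c p).
Proof.
move=> ac cp.
have Ap : cimg c (c p) by exists p.
have [W [h [oW Wp sh hE]]] := smooth_on_family
  (fun ij : 'I_n * 'I_n => gmx_smooth g ac ij.1 ij.2) Ap.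
have nA := near_chart cp (near_cdom cp).
pose V := [set y | W y /\
  (halfspace y -> exists q, [/\ cdom c q, cdom c q & c q = y])]°.
have VW : V `<=` W by move=> y /interior_subset[].
exists V, (fun y => \matrix_(i, j) h (i, j) y); split; last first.
  by apply: filterI nA; apply: open_nbhs_nbhs.
split=> [|i j|y]; first exact: open_interior.
  have := smooth_openW VW (sh (i, j)).
  rewrite (_ : (fun y => _) = h (i, j)) //.
  by apply/funext => y; rewrite mxE.
move=> /interior_subset[Wy Ay] hy; have [q [cq _ qy]] := Ay hy.
exists q => //; split=> //; apply/matrixP => i j; rewrite mxE hE //.
by rewrite -qy; exists q.
Qed.

Definition dmx m k (G : 'rV[R]_n -> 'M[R]_(m, k)) w x : 'M[R]_(m, k) :=
  \matrix_(i, j) 'D_w (fun y => G y i j) x.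

Lemma is_derive_dmx m k (G : 'rV[R]_n -> 'M[R]_(m, k)) w x :
  (forall i j, differentiable (fun y => G y i j) x) ->
  is_derive x w G (dmx G w x).
Proof.
by move=> dG; apply/is_derive_mxP => i j; rewrite mxE; apply: is_derive_diff.
Qed.

Lemma metric_ext_diff c W G y i j : metric_ext c W G -> W y ->
  differentiable (fun y => G y i j) y.
Proof. by move=> [_ sG _] Wy; apply: (sG i j [::]). Qed.

Lemma metric_extE c W G q : metric_ext c W G -> cdom c q -> W (c q) ->
  gmx g c (c q) = G (c q).
Proof.
by move=> [_ _ H] cq Wq; have [r _ [_ ->]] := H _ Wq (chart_halfspace cq).
Qed.

Lemma metric_ext_hpartial c W G q a i j : metric_ext c W G ->
  cdom c q -> W (c q) ->
  hpartial a (fun y => gmx g c y i j) (c q) =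
  'D_(delta_mx 0 a) (fun y => G y i j) (c q).
Proof.
move=> me cq Wq; apply: hpartialE; [exact: chart_halfspace|exact: metric_ext_diff me Wq|].
have [oW _ H] := me.
have : \forall y \near c q, W y by apply: open_nbhs_nbhs.
by apply: filterS => y Wy hy; have [_ _ [_ ->]] := H y Wy hy.
Qed.

(** The vector-valued quadratic map [v |-> Gamma(v, v)] of the geodesic
    equation *)
Definition gamma c (x v : 'rV[R]_n) : 'rV[R]_n :=
  \row_k \sum_(i < n) \sum_(j < n) christoffel g c k i j x * v 0 i * v 0 j.

Lemma geodesic_fieldE c (u : tangent M) :
  geodesic_field g c u = row_mx (comp u c) (- gamma c (c (base u)) (comp u c)).
Proof. by congr row_mx; apply/rowP => k; rewrite !mxE. Qed.

(** Koszul's formula on the diagonal.  As [g] is nondegenerate, it characterizes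
    [gamma] by first derivatives of [g] only, in a form which is easy to
    transport from one chart to another. *)
Lemma gamma_koszul c W G p v z : atlas c -> cdom c p ->
  metric_ext c W G -> W (c p) ->
  bil (gmx g c (c p)) (gamma c (c p) v) z =
  bil (dmx G v (c p)) v z - 2^-1 * bil (dmx G z (c p)) v v.
Proof.
move=> ac cp me Wp; set x := c p; set A := gmx g c x.
pose d a b e := 'D_(delta_mx 0 a) (fun y => G y b e) x.
(* [b] is [gamma] with its index lowered. *)
pose b : 'rV[R]_n := \row_l \sum_i \sum_j
  2^-1 * (d i j l + d j i l - d l i j) * v 0 i * v 0 j.
have gammaE : gamma c x v = b *m (invmx A)^T.
  apply/rowP => k; rewrite !mxE.
  transitivity (\sum_i \sum_j \sum_l
      2^-1 * (d i j l + d j i l - d l i j) * v 0 i * v 0 j * (invmx A)^T l k).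
    apply: eq_bigr => i _; apply: eq_bigr => j _.
    rewrite /christoffel -/A mulr_sumr !mulr_suml; apply: eq_bigr => l _.
    by rewrite !(metric_ext_hpartial _ _ _ me cp Wp) mxE -/x /d; ring.
  transitivity (\sum_i \sum_l \sum_j
      2^-1 * (d i j l + d j i l - d l i j) * v 0 i * v 0 j * (invmx A)^T l k).
    by apply: eq_bigr => i _; rewrite exchange_big.
  rewrite exchange_big; apply: eq_bigr => l _; rewrite [b 0 l]mxE mulr_suml.
  by apply: eq_bigr => i _; rewrite mulr_suml.
have bA : gamma c x v *m A = b.
  have AT : A^T = A by apply: gmx_symE.
  rewrite gammaE -mulmxA -{2}AT -trmx_mul.
  by rewrite mulmxV ?trmx1 ?mulmx1 //; apply: gmx_unit.
rewrite /bil bA.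
have dE w i j : dmx G w x i j = \sum_a w 0 a * d a i j.
  by rewrite mxE derive_coords //; apply: metric_ext_diff me Wp.
pose T := \sum_i \sum_j \sum_l v 0 i * v 0 j * z 0 l * d i j l.
pose Q := \sum_i \sum_j \sum_l v 0 i * v 0 j * z 0 l * d l i j.
have TE : bil (dmx G v x) v z = T.
  rewrite bilE /T exchange_big /=.
  under eq_bigr => l _ do under eq_bigr => j _ do
    rewrite dE mulr_sumr mulr_suml.
  rewrite exchange_big /=; under eq_bigr do rewrite exchange_big /=.
  rewrite exchange_big /=; apply: eq_bigr => i _; apply: eq_bigr => j _.
  by apply: eq_bigr => l _; ring.
have T'E : \sum_i \sum_j \sum_l v 0 i * v 0 j * z 0 l * d j i l = T.
  rewrite exchange_big /=; apply: eq_bigr => i _; apply: eq_bigr => j _.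
  by apply: eq_bigr => l _; ring.
have QE : bil (dmx G z x) v v = Q.
  rewrite bilE; apply: eq_bigr => i _; apply: eq_bigr => j _.
  rewrite dE mulr_sumr mulr_suml; apply: eq_bigr => l _; ring.
rewrite -[X in _ = X - _]/(bil _ _ _) -[X in _ = _ - _ * X]/(bil _ _ _) TE QE.
have -> : T - 2^-1 * Q = 2^-1 * (T + T - Q) by field.
rewrite -{2}T'E /T /Q -big_split -sumrB mulr_sumr mxE.
under eq_bigr do rewrite mxE mulr_suml.
rewrite exchange_big /=; apply: eq_bigr => i _.
under eq_bigr do rewrite mulr_suml.
rewrite exchange_big /= -big_split -sumrB mulr_sumr; apply: eq_bigr => j _.
rewrite -big_split -sumrB mulr_sumr; apply: eq_bigr => l _.
by rewrite mxE /=; ring.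
Qed.

End metric_geometry.

(** * Invariance of the derivative along the geodesic field *)

Section geodesic_invariance.
Context {R : realType} {n : nat} {M : manifold R n} (g : metric M).
Implicit Types (c : chart R n M) (p q : M) (v w z : 'rV[R]_n).

Lemma jacobian_mx_diff c c' W phi x i j : trans_ext c c' W phi -> W x ->
  differentiable (fun y => jacobian_mx phi y i j) x.
Proof.
move=> [_ sp _] Wx; have := sp j [:: i] x Wx.
rewrite [partials _ _]/=.
by congr (differentiable _ _); apply/funext => y; rewrite mxE.
Qed.

Lemma dmx_jacobian_sym c c' W phi x v w : trans_ext c c' W phi -> W x ->
  v *m dmx (jacobian_mx phi) w x = w *m dmx (jacobian_mx phi) v x.
Proof.
move=> te Wx; have [oW sp _] := te; apply/rowP => j.
have E (a b : 'rV[R]_n) : (a *m dmx (jacobian_mx phi) b x) 0 j = \sum_i \sum_k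
    a 0 i * b 0 k * 'D_(delta_mx 0 k) ('D_(delta_mx 0 i) (fun y => phi y 0 j)) x.
  rewrite mxE; apply: eq_bigr => i _; rewrite mxE.
  have -> : (fun y => jacobian_mx phi y i j) =
      'D_(delta_mx 0 i) (fun y => phi y 0 j) by apply/funext => y; rewrite mxE.
  rewrite derive_coords; last by apply: (sp j [:: i]).
  by rewrite mulr_sumr; apply: eq_bigr => k _; rewrite mulrA.
apply: etrans (E v w) (etrans _ (esym (E w v))); rewrite exchange_big.
apply: eq_bigr => i _; apply: eq_bigr => k _.
exact: congr2 (mulrC (v 0 k) (w 0 i)) (smooth_derive_sym i k oW Wx (sp j)).
Qed.

(** The algebra behind the change of charts for Christoffel symbols: [A] and
    [Dv], [Dz] are a metric and its derivatives along [v], [z] in one chart, the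
    primed matrices their counterparts in another one. *)
Lemma koszul_congr (A Dv Dz A' D'v D'z J dJv dJz : 'M[R]_n)
    (gam gam' v z : 'rV[R]_n) : A'^T = A' ->
  A = J *m A' *m J^T ->
  Dv = dJv *m A' *m J^T + J *m D'v *m J^T + J *m A' *m dJv^T ->
  Dz = dJz *m A' *m J^T + J *m D'z *m J^T + J *m A' *m dJz^T ->
  v *m dJz = z *m dJv ->
  bil A gam z = bil Dv v z - 2^-1 * bil Dz v v ->
  bil A' gam' (z *m J) =
    bil D'v (v *m J) (z *m J) - 2^-1 * bil D'z (v *m J) (v *m J) ->
  bil A' (gam *m J - (gam' + v *m dJv)) (z *m J) = 0.
Proof.
move=> sA' -> -> -> sym; rewrite !bil_addmx !bil_congr sym => K1 K2.
rewrite bilDl bilNl bilDl K1 K2 (bil_sym (z *m dJv) (v *m J) sA').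
by field.
Qed.

(** The inhomogeneous transformation law of the Christoffel symbols.
    Differentiate [g = J g' J^T] along [v] and along [z], and compare Koszul's
    formulas in both charts: the difference of the two sides is [g']-orthogonal
    to all vectors [z *m J x]. *)
Lemma gamma_change c c' W phi p v : atlas c -> atlas c' ->
  cdom c p -> cdom c' p -> trans_ext c c' W phi -> W (c p) ->
  let J := jacobian_mx phi in
  gamma g c (c p) v *m J (c p) =
  gamma g c' (c' p) (v *m J (c p)) + v *m dmx J v (c p).
Proof.
move=> ac ac' cp c'p te Wp J; set x := c p; set x' := c' p.
have [_ phix] := trans_extE te cp Wp.
have [V [G [me Vp]]] := metric_extP g ac cp.
have [V' [G' [me' V'p]]] := metric_extP g ac' c'p.
pose A' := gmx g c' x'.
pose K := fun y => J y *m G' (phi y) *m (J y)^T.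
have dK w : is_derive x w K
   (dmx J w x *m A' *m (J x)^T + J x *m dmx G' (w *m J x) x' *m (J x)^T
    + J x *m A' *m (dmx J w x)^T).
  have dJ : is_derive x w J (dmx J w x).
    by apply: is_derive_dmx => i j; apply: jacobian_mx_diff te Wp.
  have dG : is_derive x w (G' \o phi) (dmx G' (w *m J x) x').
    apply/is_derive_mxP => i j; rewrite mxE.
    have dG' : differentiable (fun y => G' y i j) (phi x).
      by rewrite phix; apply: metric_ext_diff me' V'p.
    have := is_derive_chain (is_derive_trans w te Wp) dG'.
    by rewrite phix.
  have := is_derive_mulmx (is_derive_mulmx dJ dG) (is_derive_tr dJ).
  by rewrite mulmxDl /= phix -(metric_extE me' c'p V'p).
have dGE w : dmx G w x = dmx J w x *m A' *m (J x)^T +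
    J x *m dmx G' (w *m J x) x' *m (J x)^T + J x *m A' *m (dmx J w x)^T.
  have dG : is_derive x w G (dmx G w x).
    by apply: is_derive_dmx => i j; apply: metric_ext_diff me Vp.
  apply: (derive_halfspace (chart_halfspace cp) dG (dK w)).
  have n1 : \forall y \near x, V' (phi y).
    apply: (trans_ext_continuous te Wp) => /=; rewrite phix.
    by have [oV' _ _] := me'; apply: open_nbhs_nbhs.
  have n2 : \forall y \near x, V y.
    by have [oV _ _] := me; apply: open_nbhs_nbhs.
  near=> y => hy.
  have Wy : W y by near: y; apply: trans_ext_near te Wp.
  have Vy : V y by near: y.
  have V'y : V' (phi y) by near: y.
  have [_ _ H] := te; have [q [cq c'q qy q'y]] := H y Wy hy.
  rewrite /K -q'y -qy in Wy Vy V'y *.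
  rewrite -(metric_extE me cq Vy) -(metric_extE me' c'q V'y).
  by rewrite (gmx_change g ac ac' cq c'q) (jacE te cq Wy).
have A'E : gmx g c x = J x *m A' *m (J x)^T.
  by rewrite (gmx_change g ac ac' cp c'p) (jacE te cp Wp).
pose v' := v *m J x; pose a := v *m dmx J v x.
pose d := gamma g c x v *m J x - (gamma g c' x' v' + a).
have sA' : A'^T = A' by apply: gmx_symE.
have bd z : bil A' d (z *m J x) = 0.
  exact: koszul_congr sA' A'E (dGE v) (dGE z) (dmx_jacobian_sym v z te Wp)
    (gamma_koszul v z ac cp me Vp) (gamma_koszul v' (z *m J x) ac' c'p me' V'p).
have dE : d = (d *m jac c' c x') *m J x.
  have -> : J x = jac c c' x := esym (jacE te cp Wp).
  by rewrite -mulmxA jac_unit // mulmx1.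
apply/eqP; rewrite -subr_eq0 -/d; apply/contraT => d0.
by have := gmx_gt0 g ac' c'p d0; rewrite {2}dE bd ltxx.
Unshelve. all: by end_near. Qed.

Lemma unit_tangentP (u : tangent M) c : atlas c -> cdom c (base u) ->
  bil (gmx g c (c (base u))) (comp u c) (comp u c) = 1 -> unit_tangent g u.
Proof.
move=> ac cu E c' ac' c'u; rewrite -[LHS]/(bil _ _ _).
by rewrite -(comp_norm_invariant g ac ac').
Qed.

(** Both sides are the derivative of [F] along one curve of unit tangent vectors,
    which projects onto the segment [t *: v + x] of the first chart.  This segment
    stays in the manifold for times of one sign at least.  With [c = c'], this
    is the independence of the extension. *)
Lemma extends_geodesic_derive (F : unit_tangent g -> R) (u : unit_tangent g)
    c c' W h W' h' : atlas c -> atlas c' ->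
  cdom c (base (val u)) -> cdom c' (base (val u)) ->
  extends F c W h -> W (tchart c (val u)) ->
  extends F c' W' h' -> W' (tchart c' (val u)) ->
  'D_(geodesic_field g c (val u)) h (tchart c (val u)) =
  'D_(geodesic_field g c' (val u)) h' (tchart c' (val u)).
Proof.
move=> ac ac' cp c'p [oW sh hF] Wu [oW' sh' h'F] W'u.
set p := base (val u) in cp c'p *; pose x := c p; pose v := comp (val u) c.
have [Wt [phi [te Wtp]]] := trans_extP ac ac' cp c'p.
have [_ phix] := trans_extE te cp Wtp.
have [V [G [me Vp]]] := metric_extP g ac cp.
pose J := jacobian_mx phi; pose gam := gamma g c x v.
(* [al] and [al'] are the two coordinate expressions of the curve; the fibre
   component is normalized to have length 1. *)
pose l (t : R) := t *: v + x.
have l0 : l 0 = x by rewrite /l scale0r add0r.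
pose y (t : R) := t *: (- gam) + v.
have y0 : y 0 = v by rewrite /y scale0r add0r.
pose s (t : R) := bil (G (l t)) (y t) (y t).
pose al t := row_mx (l t) (rsqrt (s t) *: y t).
pose al' t := row_mx (phi (l t)) (rsqrt (s t) *: y t *m J (l t)).
have vunit : bil (gmx g c x) v v = 1.
  by have /set_mem /(_ c ac cp) := valP u.
have s0 : s 0 = 1 by rewrite /s l0 y0 -(metric_extE me cp Vp).
have dl : is_derive (0 : R) 1 l v by apply: is_derive_affine.
have dy : is_derive (0 : R) 1 y (- gam) by apply: is_derive_affine.
(* The squared length is stationary at 0: the geodesic field is tangent to the
   unit tangent bundle. *)
have ds : is_derive (0 : R) 1 s 0.
  have dG : is_derive (0 : R) 1 (G \o l) (dmx G v x).
    apply/is_derive_mxP => i j; rewrite mxE.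
    have dG' : differentiable (fun y => G y i j) (l 0).
      by rewrite l0; apply: metric_ext_diff me Vp.
    by have := is_derive_chain dl dG'; rewrite l0.
  have /is_derive_mxP /(_ 0 0) ds :=
    is_derive_mulmx (is_derive_mulmx dy dG) (is_derive_tr dy).
  apply: (is_derive_eq ds).
  rewrite /= l0 y0 mulmxDl -(metric_extE me cp Vp) mxE [X in X + _]mxE.
  rewrite -!/(bil _ _ _) (bil_sym v (- gam) (gmx_symE g ac cp)) bilNl.
  rewrite (gamma_koszul v v ac cp me Vp) -/x.
  by field.
have dr : is_derive (0 : R) 1 (rsqrt \o s) 0.
  have := is_derive_comp_rsqrt (f := s) (x := 0) (v := 1) (f' := 0).
  by rewrite s0 mul0r; apply.
have dV : is_derive (0 : R) 1 (fun t => rsqrt (s t) *: y t) (- gam).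
  have := is_derive_mx_scale dr dy.
  by rewrite /= s0 rsqrt1 scale0r add0r scale1r.
have dal : is_derive (0 : R) 1 al (geodesic_field g c (val u)).
  by rewrite geodesic_fieldE; apply: is_derive_row_mx.
have dal' : is_derive (0 : R) 1 al' (geodesic_field g c' (val u)).
  rewrite geodesic_fieldE; apply: is_derive_row_mx.
    have dphi : differentiable phi (l 0).
      rewrite l0; apply: differentiable_row => j.
      by have [_ sp _] := te; apply: (sp j [::]).
    have := is_derive_chain dl dphi; rewrite l0.
    have [_ ->] := is_derive_trans v te Wtp.
    by rewrite (comp_change ac ac' cp c'p) (jacE te cp Wtp).
  have dJ : is_derive (0 : R) 1 (J \o l) (dmx J v x).
    apply/is_derive_mxP => i j; rewrite mxE.
    have dJ' : differentiable (fun y => J y i j) (l 0).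
      by rewrite l0; apply: jacobian_mx_diff te Wtp.
    by have := is_derive_chain dl dJ'; rewrite l0.
  have := is_derive_mulmx dV dJ.
  rewrite /= l0 s0 rsqrt1 scale1r y0 mulNmx.
  rewrite (gamma_change v ac ac' cp c'p te Wtp) -/J opprD subrK.
  by rewrite (comp_change ac ac' cp c'p) (jacE te cp Wtp).
have al0 : al 0 = tchart c (val u).
  by rewrite /al l0 s0 y0 rsqrt1 scale1r.
have al'0 : al' 0 = tchart c' (val u).
  rewrite /al' l0 s0 y0 rsqrt1 scale1r phix /tchart.
  by rewrite (comp_change ac ac' cp c'p) (jacE te cp Wtp).
have dh : is_derive (0 : R) 1 (h \o al)
    ('D_(geodesic_field g c (val u)) h (tchart c (val u))).
  by rewrite -al0; apply: is_derive_chain => //; rewrite al0; apply: (sh [::]).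
have dh' : is_derive (0 : R) 1 (h' \o al')
    ('D_(geodesic_field g c' (val u)) h' (tchart c' (val u))).
  by rewrite -al'0; apply: is_derive_chain => //; rewrite al'0; apply: (sh' [::]).
have cont (U : normedModType R) (f : R -> U) f' :
    is_derive (0 : R) 1 f f' -> {for (0 : R), continuous f}.
  by move=> [/derivable1_diffP df _]; apply: differentiable_continuous.
have nW : \forall t \near (0 : R), W (al t).
  by apply: (cont _ _ _ dal); rewrite al0; apply: open_nbhs_nbhs.
have nW' : \forall t \near (0 : R), W' (al' t).
  by apply: (cont _ _ _ dal'); rewrite al'0; apply: open_nbhs_nbhs.
have nV : \forall t \near (0 : R), V (l t).
  apply: (cont _ _ _ dl); rewrite l0.
  by have [oV _ _] := me; apply: open_nbhs_nbhs.
have nWt : \forall t \near (0 : R), Wt (l t).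
  by apply: (cont _ _ _ dl); rewrite l0; apply: trans_ext_near te Wtp.
have ns : \forall t \near (0 : R), 0 < s t.
  have := cont _ _ _ ds [set r : R | 0 < r]; rewrite s0; apply.
  by apply: lt_nbhsr; exact: ltr01.
apply: (is_derive_unique_half (halfspace_line v (chart_halfspace cp)) dh dh').
near=> t => /= ht.
have Wt' : Wt (l t) by near: t.
have [_ _ H] := te; have [q [cq c'q qt q't]] := H _ Wt' ht.
have [w [wq wc]] := exists_tangent (rsqrt (s t) *: y t) ac cq.
have Vt : V (c q) by rewrite qt; near: t.
have wunit : w \in unit_tangent g.
  apply/mem_set; apply: (@unit_tangentP w c); rewrite ?wq // wc.
  rewrite bilZl bilZr (metric_extE me cq Vt) qt -/(s t) mulrA -expr2 rsqrt_sqr //.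
  by near: t.
have wal : tchart c w = al t by rewrite /tchart wq wc qt.
have wal' : tchart c' w = al' t.
  rewrite /tchart wq q't (comp_change ac ac') ?wq // wc.
  by rewrite (jacE te cq) qt.
have := hF (exist _ w wunit); have := h'F (exist _ w wunit).
rewrite /= wq wal wal' => -> //; last by near: t.
by move=> -> //; near: t.
Unshelve. all: by end_near. Qed.

End geodesic_invariance.

(** * Functions constant along rays *)

Section normalization.
Context {R : realType} {n : nat} {M : manifold R n}.
Implicit Types (g : metric M) (c : chart R n M) (u : tangent M).

(** Any extension computes [dSM], whose definition picks an unspecified one. *)
Lemma dSM_geodesicE g (F : unit_tangent g -> R) (u : unit_tangent g) c W h :
  atlas c -> cdom c (base (val u)) ->
  extends F c W h -> W (tchart c (val u)) ->
  dSM F c u (geodesic_field g c (val u)) =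
  'D_(geodesic_field g c (val u)) h (tchart c (val u)).
Proof.
move=> ac cu hF Wu; rewrite /dSM; set S := [set l | _].
have : S (xget 0 S).
  apply: xgetPex.
  by exists ('D_(geodesic_field g c (val u)) h (tchart c (val u))), W, h.
move=> [W' [h' [h'F W'u ->]]].
exact: (extends_geodesic_derive ac ac cu cu h'F W'u hF Wu).
Qed.

Lemma scale_comp_out (r : R) u c : ~ (atlas c /\ cdom c (base u)) ->
  r *: comp u c = 0.
Proof. by move=> /comp_out ->; rewrite scaler0. Qed.

Lemma scale_comp_change (r : R) u c c' : atlas c -> atlas c' ->
  cdom c (base u) -> cdom c' (base u) ->
  r *: comp u c' = (r *: comp u c) *m jac c c' (c (base u)).
Proof. by move=> ac ac' cu c'u; rewrite -scalemxAl -(comp_change ac ac'). Qed.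

Definition scale_tangent (r : R) u : tangent M :=
  Tangent (scale_comp_out r (u := u)) (scale_comp_change r (u := u)).

Definition sqnorm g u : R := xget 0 [set l | exists c,
  [/\ atlas c, cdom c (base u) &
      l = bil (gmx g c (c (base u))) (comp u c) (comp u c)]].

Lemma sqnormE g u c : atlas c -> cdom c (base u) ->
  sqnorm g u = bil (gmx g c (c (base u))) (comp u c) (comp u c).
Proof.
move=> ac cu; rewrite /sqnorm; set S := [set l | _].
have : S (xget 0 S).
  by apply: xgetPex; exists (bil (gmx g c (c (base u))) (comp u c) (comp u c)), c.
by move=> [c' [ac' c'u ->]]; apply: comp_norm_invariant.
Qed.

Lemma tangent_eq (u w : tangent M) : base u = base w -> comp u = comp w -> u = w.
Proof.
case: u w => [p k ko kc] [p' k' k'o k'c] /= E E'; subst p' k'.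
by congr Tangent; exact: Prop_irrelevance.
Qed.

Lemma scale_tangent1 u : scale_tangent 1 u = u.
Proof. by apply: tangent_eq => //=; apply/funext => c; rewrite scale1r. Qed.

Lemma unit_tangent_bil g (u : unit_tangent g) c :
  atlas c -> cdom c (base (val u)) ->
  bil (gmx g c (c (base (val u)))) (comp (val u) c) (comp (val u) c) = 1.
Proof. by move=> ac cu; have /set_mem /(_ c ac cu) := valP u. Qed.

Lemma unit_tangent_neq0 g (u : unit_tangent g) c :
  atlas c -> cdom c (base (val u)) -> comp (val u) c != 0.
Proof.
move=> ac cu; apply/eqP => u0; have := unit_tangent_bil ac cu.
by rewrite u0 /bil !mul0mx mxE => /esym/eqP; rewrite oner_eq0.
Qed.

Lemma dSM_geodesic_chart g (F : unit_tangent g -> R) (u : unit_tangent g) c c' :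
  smooth_SM F -> atlas c -> atlas c' ->
  cdom c (base (val u)) -> cdom c' (base (val u)) ->
  dSM F c u (geodesic_field g c (val u)) = dSM F c' u (geodesic_field g c' (val u)).
Proof.
move=> sF ac ac' cu c'u.
have [W [h [hF Wu]]] := sF u c ac cu.
have [W' [h' [h'F W'u]]] := sF u c' ac' c'u.
rewrite (dSM_geodesicE ac cu hF Wu) (dSM_geodesicE ac' c'u h'F W'u).
exact: (extends_geodesic_derive ac ac' cu c'u hF Wu h'F W'u).
Qed.

(** Constant along rays; zero vectors, which cannot be normalized, get the
    value 0. *)
Definition radial_ext g (F : unit_tangent g -> R) u : R :=
  if insub (scale_tangent (rsqrt (sqnorm g u)) u) is Some w then F w else 0.

Lemma radial_ext_unit g (F : unit_tangent g -> R) (u : unit_tangent g) :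
  radial_ext F (val u) = F u.
Proof.
have [c ac cu] := atlas_cover (base (val u)).
rewrite /radial_ext (sqnormE g ac cu) unit_tangent_bil // rsqrt1.
by rewrite scale_tangent1 valK.
Qed.

Lemma normalized_unit g u c : atlas c -> cdom c (base u) -> comp u c != 0 ->
  scale_tangent (rsqrt (sqnorm g u)) u \in unit_tangent g.
Proof.
move=> ac cu u0; apply/mem_set; apply: (unit_tangentP ac) => //=.
rewrite bilZl bilZr (sqnormE g ac cu) mulrA -expr2 rsqrt_sqr //.
exact: gmx_gt0.
Qed.

(** In a chart, [H (x, v) = h (x, v / |v|)] where [h] extends [F] and the norm is
    that of a smooth extension [G] of the matrix of [g].  The pair [W], [H] does
    not involve any other metric, which is what makes it usable for all of them
    at once. *)
Lemma radial_ext_smooth g (F : unit_tangent g -> R) u0 c : smooth_SM F ->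
  atlas c -> cdom c (base u0) -> comp u0 c != 0 ->
  exists W H, [/\ open W, smooth_open W H, W (tchart c u0) &
    forall u, cdom c (base u) -> W (tchart c u) ->
      H (tchart c u) = radial_ext F u].
Proof.
move=> sF ac cu0 u00.
pose w0 := exist (fun u => u \in unit_tangent g) _
  (normalized_unit g ac cu0 u00) : unit_tangent g.
have [Wh [h [[oWh sh hF] Whw]]] := sF w0 c ac cu0.
have [V [G [me Vu]]] := metric_extP g ac cu0.
have [oV sG _] := me.
pose q (z : 'rV[R]_(n + n)) := bil (G (lsubmx z)) (rsubmx z) (rsubmx z).
pose P (z : 'rV[R]_(n + n)) := row_mx (lsubmx z) (rsqrt (q z) *: rsubmx z).
pose W1 := [set z : 'rV[R]_(n + n) | V (lsubmx z)].
have oW1 : open W1.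
  apply: open_comp oV => z _; apply: differentiable_continuous.
  exact: differentiable_lsubmx.
have sq k : smooth_upto k W1 q.
  rewrite (_ : q = fun z => \sum_i \sum_j
      z 0 (rshift n i) * G (lsubmx z) i j * z 0 (rshift n j)); last first.
    apply/funext => z; rewrite /q bilE; apply: eq_bigr => i _.
    by apply: eq_bigr => j _; rewrite !mxE.
  apply: (smooth_upto_sum oW1) => i; apply: (smooth_upto_sum oW1) => j.
  apply: (smooth_uptoM oW1); last exact: smooth_upto_coord.
  apply: (smooth_uptoM oW1); first exact: smooth_upto_coord.
  apply: (smooth_upto_comp (p := lsubmx) (W' := V) (f := fun y => G y i j) oW1).
  - move=> l; have := @smooth_upto_coord R k _ W1 (lshift n l).
    by apply: smooth_upto_eq => // z _; rewrite mxE.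
  - by [].
  - by have /smooth_openE := sG i j; apply.
pose W2 := [set z | W1 z /\ 0 < q z].
have oW2 : open W2.
  rewrite openE => z [W1z qz]; apply: filterI.
    by apply: open_nbhs_nbhs.
  have cq : {for z, continuous q}.
    exact/differentiable_continuous/(smooth_upto_diff (sq 0%N) W1z).
  by have := cq [set r | 0 < r]; apply; apply: lt_nbhsr.
have W21 : W2 `<=` W1 by move=> z [].
have sP k l : smooth_upto k W2 (fun z => P z 0 l).
  case: (split_ordP l) => i ->.
    have := @smooth_upto_coord R k _ W2 (lshift n i).
    by apply: smooth_upto_eq => // z _; rewrite row_mxEl mxE.
  have sr : smooth_upto k W2 (rsqrt \o q).
    by apply: (smooth_upto_rsqrt oW2) (smooth_uptoSW W21 (sq k)) => z [].
  have := smooth_uptoM oW2 sr (@smooth_upto_coord R k _ W2 (rshift n i)).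
  by apply: smooth_upto_eq => // z _; rewrite row_mxEr !mxE.
pose W := [set z | W2 z /\ Wh (P z)].
have WW2 : W `<=` W2 by move=> z [].
have oW : open W.
  rewrite openE => z [W2z Whz]; apply: filterI.
    by apply: open_nbhs_nbhs.
  have cP : {for z, continuous P}.
    apply/differentiable_continuous/differentiable_row => l.
    exact: smooth_upto_diff (sP 0%N l) W2z.
  by have := cP Wh; apply; apply: open_nbhs_nbhs.
have PE u : cdom c (base u) -> V (c (base u)) ->
    P (tchart c u) = tchart c (scale_tangent (rsqrt (sqnorm g u)) u).
  move=> cu Vcu; rewrite /P /q /tchart row_mxKl row_mxKr /= (sqnormE g ac cu).
  by rewrite (metric_extE me cu Vcu).
have qE u : cdom c (base u) -> V (c (base u)) -> q (tchart c u) = sqnorm g u.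
  move=> cu Vcu; rewrite /q /tchart row_mxKl row_mxKr (sqnormE g ac cu).
  by rewrite (metric_extE me cu Vcu).
exists W, (h \o P); split => //.
- apply/smooth_openE => k; apply: (smooth_upto_comp oW (W' := Wh)).
  + by move=> l; apply: smooth_uptoSW WW2 (sP k l).
  + by move=> z [].
  + by have /smooth_openE := sh; apply.
- have W1u : W1 (tchart c u0) by rewrite /W1 /= row_mxKl.
  split; last by rewrite PE.
  split=> //; rewrite qE // (sqnormE g ac cu0); exact: gmx_gt0.
move=> u cu [[W1u qu] WhP].
have Vcu : V (c (base u)) by move: W1u; rewrite /W1 /= row_mxKl.
have u_neq0 : comp u c != 0.
  apply: contraTneq qu => uc0; rewrite qE // (sqnormE g ac cu) uc0.
  by rewrite /bil mul0mx mul0mx mxE ltxx.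
have wu := normalized_unit g ac cu u_neq0.
rewrite /radial_ext insubT /= PE //.
by have <- := hF (exist (fun u => u \in unit_tangent g) _ wu);
  rewrite /= -?PE.
Qed.

Lemma radial_ext_extends g g' (F : unit_tangent g -> R) c W H :
  open W -> smooth_open W H ->
  (forall u, cdom c (base u) -> W (tchart c u) -> H (tchart c u) = radial_ext F u) ->
  extends (fun u : unit_tangent g' => radial_ext F (val u)) c W H.
Proof. by move=> oW sH HF; split=> // u cu Wu; apply: HF. Qed.

Lemma smooth_radial_ext g g' (F : unit_tangent g -> R) : smooth_SM F ->
  smooth_SM (fun u : unit_tangent g' => radial_ext F (val u)).
Proof.
move=> sF u c ac cu.
have [W [H [oW sH Wu HF]]] :=
  radial_ext_smooth sF ac cu (unit_tangent_neq0 ac cu).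
by exists W, H; split=> //; apply: radial_ext_extends.
Qed.

End normalization.

(** * Continuity with respect to the metric *)

Section cvg_matrix.
Context {R : realType} {T : Type} {F : set_system T} {FF : Filter F}.

Lemma cvg_bigsum (I : Type) (r : seq I) (P : pred I) (f : I -> T -> R) l :
  (forall i, P i -> f i t @[t --> F] --> l i) ->
  \sum_(i <- r | P i) f i t @[t --> F] --> \sum_(i <- r | P i) l i.
Proof. by move=> fl; apply: cvg_big => //; exact: add_continuous. Qed.

Lemma cvg_det n (A : T -> 'M[R]_n) (A0 : 'M[R]_n) :
  (forall i j, A t i j @[t --> F] --> A0 i j) ->
  \det (A t) @[t --> F] --> \det A0.
Proof.
move=> cA; rewrite /determinant; apply: cvg_bigsum => s _.
apply: cvgM; first exact: cvg_cst.
by apply: cvg_big => [|i _]; [exact: mul_continuous|exact: cA].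
Qed.

(** By Cramer's rule *)
Lemma cvg_invmx n (A : T -> 'M[R]_n) (A0 : 'M[R]_n) k l :
  (forall i j, A t i j @[t --> F] --> A0 i j) -> A0 \in unitmx ->
  (\forall t \near F, A t \in unitmx) ->
  invmx (A t) k l @[t --> F] --> invmx A0 k l.
Proof.
move=> cA uA0 uA.
have invE (B : 'M[R]_n) : B \in unitmx -> invmx B k l = (\det B)^-1 * cofactor B l k.
  by move=> uB; rewrite /invmx uB !mxE.
rewrite (invE _ uA0).
apply: (@cvg_trans _ ((\det (A t))^-1 * cofactor (A t) l k @[t --> F])).
  by apply: near_eq_cvg; apply: filterS uA => t /invE ->.
apply: cvgM.
  by apply: cvgV; [rewrite -unitfE -unitmxE|apply: cvg_det].
apply: cvgM; first exact: cvg_cst.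
apply: cvg_det => i j; rewrite !mxE.
by under eq_cvg do rewrite !mxE; apply: cA.
Qed.

Lemma cvg_mx m n (A : T -> 'M[R]_(m, n)) (A0 : 'M[R]_(m, n)) :
  (forall i j, A t i j @[t --> F] --> A0 i j) -> A t @[t --> F] --> A0.
Proof.
move=> cA U [P AP PU].
have H : \forall t \near F, forall i j, P i j (A t i j).
  have H i : \forall t \near F, forall j, P i j (A t i j).
    have {}H j : \forall t \near F, P i j (A t i j) by apply: cA; apply: AP.
    exact: filter_forall H.
  exact: filter_forall H.
by apply: filterS H => t; apply: PU.
Qed.

Lemma cvg_bil n (A : T -> 'M[R]_n) (a b : T -> 'rV[R]_n)
    (A0 : 'M[R]_n) (a0 b0 : 'rV[R]_n) :
  (forall i j, A t i j @[t --> F] --> A0 i j) ->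
  (forall i, a t 0 i @[t --> F] --> a0 0 i) ->
  (forall i, b t 0 i @[t --> F] --> b0 0 i) ->
  bil (A t) (a t) (b t) @[t --> F] --> bil A0 a0 b0.
Proof.
move=> cA ca cb; rewrite bilE; under eq_cvg do rewrite bilE.
apply: cvg_bigsum => i _; apply: cvg_bigsum => j _.
by apply: cvgM => //; apply: cvgM.
Qed.

End cvg_matrix.

Section metric_topology.
Context {R : realType} {n : nat} {M : manifold R n}.
Context (cM : compact [set: M]).
Implicit Types (g : metric M) (c : chart R n M) (p : M).

Lemma near_metric g0 c (K : set M) (e : R) : atlas c -> compact K ->
  K `<=` cdom c -> 0 < e ->
  \forall g \near g0, forall s p i j, (size s <= 1)%N -> K p ->
     `|hpartials s (fun x => gmx g c x i j) (c p)
       - hpartials s (fun x => gmx g0 c x i j) (c p)| < e.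
Proof.
move=> ac cK Kc e0; pose B := [set g | forall s p i j, (size s <= 1)%N -> K p ->
  `|hpartials s (fun x => gmx g c x i j) (c p)
    - hpartials s (fun x => gmx g0 c x i j) (c p)| < e].
apply: (open_nbhs_nbhs (A := B)); split; last first.
  by move=> s p i j _ _; rewrite subrr normr0.
have SB : Cinfty_subbase B by exists g0, c, K, 1%N, e.
exists [set B]; last by rewrite bigcup_set1.
by move=> _ ->; exact: (finI_from1 id SB).
Qed.

Lemma compact_nbhs (U : set M) p : nbhs p U ->
  exists2 K, compact K & nbhs p K /\ K `<=` U.
Proof.
move=> pU.
have [B pB BU] := compact_regular (@manifold_hausdorff _ _ M) cM filterT pU.
exists (closure B); last by split=> //; apply: filterS pB; apply: subset_closure.
by apply: (subclosed_compact _ cM) => //; exact: closed_closure.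
Qed.

(** Joint continuity in the point and the metric: closeness to [g0] is uniform
    on a compact neighbourhood of [p0], and for [g0] itself the values are those
    of a smooth extension. *)
Lemma hpartials_cvg g0 c p0 s i j : atlas c -> cdom c p0 -> (size s <= 1)%N ->
  hpartials s (fun x => gmx pg.2 c x i j) (c pg.1) @[pg --> (p0, g0)] -->
  hpartials s (fun x => gmx g0 c x i j) (c p0).
Proof.
move=> ac cp0 s1; have [K cK [pK Kc]] := compact_nbhs (near_cdom cp0).
have [W [G [me Wp]]] := metric_extP g0 ac cp0.
have [oW sG _] := me.
have sE p : cdom c p -> W (c p) -> hpartials s (fun x => gmx g0 c x i j) (c p) =
    partials s (fun y => G y i j) (c p).
  case: s s1 => [|a [|b s s1]]; last by discriminate s1.
    move=> _ cp Wp'.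
    change (gmx g0 c (c p) i j = G (c p) i j).
    by rewrite (metric_extE me cp Wp').
  move=> _ cp Wp'; exact: (metric_ext_hpartial a i j me cp Wp').
have nW : \forall p \near p0, W (c p).
  by apply: (chart_continuous cp0); apply: open_nbhs_nbhs.
apply/cvgrPdist_lt => e e0.
have e20 : 0 < e / 2 by rewrite divr_gt0.
pose f g p := hpartials s (fun x => gmx g c x i j) (c p).
have H1 : \forall p \near p0, K p /\ `|f g0 p0 - f g0 p| < e / 2.
  have cG : {for p0, continuous (partials s (fun y => G y i j) \o c)}.
    apply: continuous_comp; first exact: chart_continuous.
    by apply: differentiable_continuous; apply: sG.
  have /cvgrPdist_lt /(_ _ e20) := cG.
  move=> /= nG.
  near=> p.
  have Kp : K p by near: p.
  split=> //; rewrite /f (sE p0 cp0 Wp) (sE p (Kc _ Kp)); last by near: p.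
  by near: p.
have H2 : \forall g \near g0, forall p, K p -> `|f g p - f g0 p| < e / 2.
  by apply: filterS (near_metric g0 ac cK Kc e20) => g H p; apply: H.
have H1' : \forall pg \near (p0, g0), K pg.1 /\ `|f g0 p0 - f g0 pg.1| < e / 2.
  exact: (cvg_fst H1).
have H2' : \forall pg \near (p0, g0), forall p, K p ->
    `|f pg.2 p - f g0 p| < e / 2 by exact: (cvg_snd H2).
apply: filterS2 H1' H2' => -[p g] /= [Kp H3] H4.
apply: le_lt_trans (ler_distD (f g0 p) _ _) _; rewrite [ltRHS]splitr.
apply: ltrD; first exact: H3.
by rewrite distrC; apply: H4.
Unshelve. all: by end_near. Qed.

Lemma christoffel_cvg g0 c p0 k i j : atlas c -> cdom c p0 ->
  christoffel pg.2 c k i j (c pg.1) @[pg --> (p0, g0)] -->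
  christoffel g0 c k i j (c p0).
Proof.
move=> ac cp0; rewrite /christoffel; apply: cvgM; first exact: cvg_cst.
have cd a b e : hpartial a (fun x => gmx pg.2 c x b e) (c pg.1)
    @[pg --> (p0, g0)] --> hpartial a (fun x => gmx g0 c x b e) (c p0).
  exact: (hpartials_cvg (s := [:: a])).
apply: cvg_bigsum => l _; apply: cvgM; last by apply: cvgB => //; apply: cvgD.
apply: cvg_invmx.
- by move=> a b; exact: (hpartials_cvg (s := [::])).
- exact: gmx_unit.
- exists (cdom c, setT) => [|[p g] [/= cp _]]; last exact: gmx_unit.
  by split; [exact: near_cdom|exact: filterT].
Qed.

Lemma gamma_cvg g0 c p0 (v0 : 'rV[R]_n) k : atlas c -> cdom c p0 ->
  gamma z.2.2 c (c z.2.1) z.1 0 k @[z --> (v0, (p0, g0))] -->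
  gamma g0 c (c p0) v0 0 k.
Proof.
move=> ac cp0; rewrite mxE; under eq_cvg do rewrite mxE.
have cv i : (z.1 : 'rV[R]_n) 0 i @[z --> (v0, (p0, g0))] --> v0 0 i.
  apply: (@cvg_comp _ _ _ fst (fun v : 'rV[R]_n => v 0 i)); first exact: cvg_fst.
  exact: coord_continuous.
apply: cvg_bigsum => i _; apply: cvg_bigsum => j _.
apply: cvgM => //; apply: cvgM => //.
apply: (@cvg_comp _ _ _ snd (fun pg => christoffel pg.2 c k i j (c pg.1))).
  exact: cvg_snd.
exact: christoffel_cvg.
Qed.

End metric_topology.

(** * Openness *)

Section gradient_metrics.
Context {R : realType} {n : nat} {M : manifold R n}.
Context (cM : compact [set: M]).
Implicit Types (g : metric M) (c : chart R n M) (p : M) (v : 'rV[R]_n).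

Lemma metric_bil_cvg g0 c p0 v0 : atlas c -> cdom c p0 ->
  bil (gmx z.2.2 c (c z.2.1)) z.1 z.1 @[z --> (v0, (p0, g0))] -->
  bil (gmx g0 c (c p0)) v0 v0.
Proof.
move=> ac cp0.
have cv i : (z.1 : 'rV[R]_n) 0 i @[z --> (v0, (p0, g0))] --> v0 0 i.
  apply: (@cvg_comp _ _ _ fst (fun v : 'rV[R]_n => v 0 i)); first exact: cvg_fst.
  exact: coord_continuous.
apply: cvg_bil => // i j.
apply: (@cvg_comp _ _ _ snd (fun pg => gmx pg.2 c (c pg.1) i j)).
  exact: cvg_snd.
exact: (hpartials_cvg cM (s := [::])).
Qed.

(** By compactness of the sphere [S] of the coordinate norm, the squared lengths
    of its points are bounded below by some [1 / N], uniformly in nearby points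
    and metrics; the filter at infinity provides [N]. *)
Lemma unit_vectors_bounded g0 c p0 : atlas c -> cdom c p0 ->
  exists N : R, \forall pg \near (p0, g0), forall v,
    bil (gmx pg.2 c (c pg.1)) v v = 1 -> `|v| <= N.
Proof.
move=> ac cp0; pose S := [set v : 'rV[R]_n | `|v| = 1].
have cS : compact S.
  apply: bounded_closed_compact.
    exists 1; split=> [|x x1 v /= ->]; [exact: num_real|exact: ltW].
  apply: (@closed_comp _ _ (fun v : 'rV[R]_n => `|v|) [set 1]) => [v _|].
    exact: norm_continuous.
  exact: closed_eq.
have pos s0 : S s0 -> \forall s \near s0 & pgN \near
    filter_prod (nbhs (p0, g0)) (pinfty_nbhs R),
    1 < pgN.2 * bil (gmx pgN.1.2 c (c pgN.1.1)) s s.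
  move=> s1; set b0 := bil (gmx g0 c (c p0)) s0 s0.
  have b0_gt0 : 0 < b0.
    by apply: gmx_gt0 => //; rewrite -normr_gt0 s1.
  have b20 : 0 < b0 / 2 by rewrite divr_gt0.
  have nb : \forall z \near (s0, (p0, g0)),
      b0 / 2 < bil (gmx z.2.2 c (c z.2.1)) z.1 z.1.
    have := @metric_bil_cvg g0 c p0 s0 ac cp0 [set r | b0 / 2 < r].
    apply; apply: lt_nbhsr; rewrite ltr_pdivrMr // ltr_pMr // ltr1n //.
  have [[Q1 Q2] [/= H1 H2] Q12] := nb.
  exists (Q1, [set pgN | Q2 pgN.1 /\ (b0 / 2)^-1 < pgN.2]).
    split=> //=; exists (Q2, [set N | (b0 / 2)^-1 < N]); last by move=> [].
    split=> //=; apply: nbhs_pinfty_gt; exact: num_real.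
  move=> [s [pg N]] /= [Q1s [Q2pg hN]].
  have := Q12 (s, pg) (conj Q1s Q2pg) => /= hb.
  rewrite -(mulVf (lt0r_neq0 b20)). 
  by apply: ltr_pM => //; rewrite ?invr_ge0 ltW.
have [[Q1 Q2] [/= H1 H2] Q12] := (compact_near_coveringP S).1 cS _ _ _ _ pos.
have [N [QN N0]] := filter_ex (filterI H2 (nbhs_pinfty_gt (num_real (0 : R)))).
exists (N + 1); apply: filterS H1 => pg Qpg v v1.
have v0 : v != 0.
  apply/eqP => v0; move: v1; rewrite v0 /bil mul0mx mul0mx mxE => /esym /eqP.
  by rewrite oner_eq0.
have nv : 0 < `|v| by rewrite normr_gt0.
have Sv : S (`|v|^-1 *: v).
  by rewrite /S /= normrZ ger0_norm ?invr_ge0 ?normr_ge0 // mulVf // gt_eqF.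
have /= := Q12 (pg, N) (conj Qpg QN) _ Sv.
rewrite bilZl bilZr v1 mulr1 -invfM ltr_pdivlMr ?mulr_gt0 // mul1r => h.
rewrite leNgt; apply/negP => h2.
have : `|v| * `|v| < `|v| * `|v|.
  apply: (lt_trans h); apply: (@le_lt_trans _ _ (N + 1)); first by rewrite lerDl.
  apply: (lt_trans h2); rewrite ltr_pMl // (lt_trans _ h2) // ltrDr //.
by rewrite ltxx.
Qed.

(** If [v0] is not a unit vector of [g0] at [p0], no nearby [z] carries a unit
    vector and the claim is void.  Allowing all [v0] makes it possible to work in
    one fixed ball, which contains the unit spheres of all nearby metrics. *)
Lemma geodesic_derive_positive g0 (F : unit_tangent g0 -> R) c p0 v0 :
  smooth_SM F ->
  (forall u c, atlas c -> cdom c (base (val u)) ->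
     0 < dSM F c u (geodesic_field g0 c (val u))) ->
  atlas c -> cdom c p0 ->
  \forall z \near (v0, (p0, g0)), forall u : unit_tangent z.2.2,
    base (val u) = z.2.1 -> comp (val u) c = z.1 ->
    0 < dSM (fun w : unit_tangent z.2.2 => radial_ext F (val w)) c u
          (geodesic_field z.2.2 c (val u)).
Proof.
move=> sF posF ac cp0.
have ncp : \forall z \near (v0, (p0, g0)), cdom c z.2.1.
  have ncp : \forall pg \near (p0, g0), cdom c pg.1.
    exact: (cvg_fst (near_cdom cp0)).
  exact: (cvg_snd ncp).
have [v1|v1] := eqVneq (bil (gmx g0 c (c p0)) v0 v0) 1; last first.
  have nb : \forall z \near (v0, (p0, g0)),
      bil (gmx z.2.2 c (c z.2.1)) z.1 z.1 != 1.
    have := @metric_bil_cvg g0 c p0 v0 ac cp0 [set r | r != 1].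
    by apply; apply: open_nbhs_nbhs; split; first exact: open_neq.
  apply: filterS2 ncp nb => -[v [p g]] /= cp nb u up uv.
  by move: nb; rewrite -uv -up unit_tangent_bil ?eqxx ?up.
have [u0 [u0p u0v]] := exists_tangent v0 ac cp0.
have u0_unit : u0 \in unit_tangent g0.
  by apply/mem_set; apply: (unit_tangentP ac); rewrite u0p ?u0v.
pose w0 := exist (fun u => u \in unit_tangent g0) _ u0_unit : unit_tangent g0.
have cu0 : cdom c (base u0) by rewrite u0p.
have v0_neq0 : comp u0 c != 0.
  rewrite u0v; apply/eqP => v00; move: v1.
  by rewrite v00 /bil !mul0mx mxE => /esym/eqP; rewrite oner_eq0.
have [W [H [oW sH Wu0 HF]]] := radial_ext_smooth sF ac cu0 v0_neq0.
have HFg g : extends (fun w : unit_tangent g => radial_ext F (val w)) c W H.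
  exact: radial_ext_extends oW sH HF.
have HF0 : extends F c W H.
  by split=> // u cu Wu; rewrite HF // radial_ext_unit.
have pos0 : 0 < 'D_(geodesic_field g0 c u0) H (tchart c u0).
  have := posF w0 c ac cu0.
  by rewrite (dSM_geodesicE (u := w0) ac cu0 HF0 Wu0).
have dH x : W x -> forall w, 'D_w H x = \sum_i w 0 i * 'D_(delta_mx 0 i) H x.
  by move=> Wx w; rewrite derive_coords //; apply: (sH [::]).
pose geo (z : 'rV[R]_n * (M * metric M)) :=
  row_mx z.1 (- gamma z.2.2 c (c z.2.1) z.1).
pose pt (z : 'rV[R]_n * (M * metric M)) := row_mx (c z.2.1) z.1.
pose z0 := (v0, (p0, g0)).
have u0E : tchart c u0 = pt z0 by rewrite /tchart u0p u0v.
have cv i : (z.1 : 'rV[R]_n) 0 i @[z --> z0] --> v0 0 i.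
  apply: (@cvg_comp _ _ _ fst (fun v : 'rV[R]_n => v 0 i)); first exact: cvg_fst.
  exact: coord_continuous.
have cpt : pt z @[z --> z0] --> pt z0.
  have cc : c z.2.1 @[z --> z0] --> c p0.
    apply: (@cvg_comp _ _ _ (fun z => z.2.1) c); last exact: chart_continuous.
    by apply: (@cvg_comp _ _ _ snd fst); [exact: cvg_snd|exact: cvg_fst].
  apply: cvg_mx => i j; rewrite !mxE ord1; under eq_cvg do rewrite mxE.
  case: split_ordP => k _; last exact: cv.
  apply: (@cvg_comp _ _ _ _ (fun x : 'rV[R]_n => x 0 k)) cc _.
  exact: coord_continuous.
have nW : \forall z \near z0, W (pt z).
  by apply: cpt; apply: open_nbhs_nbhs; split=> //; rewrite -u0E.
have npos : \forall z \near z0, 0 < \sum_i geo z 0 i * 'D_(delta_mx 0 i) H (pt z).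
  have cpos : \sum_i geo z 0 i * 'D_(delta_mx 0 i) H (pt z) @[z --> z0] -->
      \sum_i geo z0 0 i * 'D_(delta_mx 0 i) H (pt z0).
    apply: cvg_bigsum => i _; apply: cvgM; last first.
      have cD : {for pt z0, continuous ('D_(delta_mx 0 i) H)}.
        by apply: differentiable_continuous; apply: (sH [:: i]); rewrite -u0E.
      exact: (@cvg_comp _ _ _ pt ('D_(delta_mx 0 i) H) _ _ _ cpt cD).
    rewrite !mxE; under eq_cvg do rewrite mxE.
    case: split_ordP => k _; first exact: cv.
    have gc := @gamma_cvg _ _ _ cM g0 c p0 v0 k ac cp0.
    have {}gc : - gamma z.2.2 c (c z.2.1) z.1 0 k @[z --> z0] -->
        - gamma g0 c (c p0) v0 0 k by exact: cvgN gc.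
    rewrite mxE /=; apply: cvg_trans gc.
    by apply: near_eq_cvg; near=> z; rewrite [in RHS]mxE.
  have := cpos [set r | 0 < r]; apply; apply: lt_nbhsr.
  by rewrite -(dH _ _ (geo z0)) -u0E // /geo /= -u0p -u0v -geodesic_fieldE.
near=> z => u up uv.
have cz : cdom c z.2.1 by near: z.
have ptE : tchart c (val u) = pt z by rewrite /tchart up uv.
have Wz : W (pt z) by near: z.
rewrite (dSM_geodesicE ac _ (HFg _)) ?up ?ptE // dH // geodesic_fieldE up uv.
by near: z.
Unshelve. all: by end_near. Qed.

End gradient_metrics.

Theorem lemma2p1 (R : realType) (n : nat) (M : manifold R n) :
  compact [set: M] -> connected [set: M] ->
  open [set g : metric M | gradient_type g].
Proof.
move=> cM _; rewrite openE => g0 [F sF posF].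
pose Fg g (w : unit_tangent g) := radial_ext F (val w).
pose good g p := forall u : unit_tangent g, base (val u) = p -> exists c,
  [/\ atlas c, cdom c p & 0 < dSM (Fg g) c u (geodesic_field g c (val u))].
have near_p p0 : [set: M] p0 -> \forall p \near p0 & g \near g0, good g p.
  move=> _.
  have [c ac cp0] := atlas_cover p0.
  have [N hN] := unit_vectors_bounded cM g0 ac cp0.
  pose D := [set v : 'rV[R]_n | `|v| <= N].
  have cD : compact D.
    apply: bounded_closed_compact.
      by exists N; split=> [|x Nx v /= /le_trans]; [exact: num_real|apply; exact: ltW].
    apply: (@closed_comp _ _ (fun v : 'rV[R]_n => `|v|) [set r | r <= N]) => [v _|].
      exact: norm_continuous.
    exact: closed_le.
  pose pos (pg : M * metric M) v := forall u : unit_tangent pg.2,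
    base (val u) = pg.1 -> comp (val u) c = v ->
    0 < dSM (Fg pg.2) c u (geodesic_field pg.2 c (val u)).
  have near_v v0 : D v0 -> \forall v \near v0 & pg \near (p0, g0), pos pg v.
    move=> _; have := geodesic_derive_positive cM v0 sF posF ac cp0.
    by apply: filterS => -[v [p g]].
  have hD : \forall pg \near (p0, g0), D `<=` pos pg.
    exact: (compact_near_coveringP D).1 cD _ _ _ _ near_v.
  have ncp : \forall pg \near (p0, g0), cdom c pg.1.
    exact: (cvg_fst (near_cdom cp0)).
  have : \forall pg \near (p0, g0), good pg.2 pg.1.
    near=> pg => u up; exists c.
    have cp : cdom c pg.1 by near: pg.
    split=> //.
    have hd : D `<=` pos pg by near: pg.
    apply: (hd (comp (val u) c)) => //; rewrite /D /=.
    have hv' : forall v, bil (gmx pg.2 c (c pg.1)) v v = 1 -> `|v| <= N.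
      by near: pg.
    by apply: hv'; rewrite -up unit_tangent_bil // up.
  by apply: filterS => -[p g].
have near_g : \forall g \near g0, [set: M] `<=` good g.
  exact: (compact_near_coveringP [set: M]).1 cM _ _ _ _ near_p.
apply: filterS near_g => g hg; exists (Fg g).
  exact: smooth_radial_ext.
move=> u c ac cu.
have [c' [ac' c'u pos']] := hg (base (val u)) I u erefl.
by rewrite (dSM_geodesic_chart (smooth_radial_ext sF) ac ac' cu c'u).
Unshelve. all: by end_near. Qed.
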